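(* Let $\hat S^{\nu}_{2}$ be the Pick-Freeze $U$-statistic estimator, based on sample size $N$, of the ball sensitivity numerator $S^{\nu}_{2}$ (both defined in the context). For every $s>0$ there exists $N_0$ such that if $N>N_0$, $$P\left(\left|\hat S^{\nu}_{2}-S^{\nu}_{2}\right|>s\right)\le 16\exp\left\{-\frac{N\left(\frac{s}{9}\right)^2}{8}\right\}.$$
   Context: Setting. $(\mathcal{M},g)$ is a connected, oriented Riemannian manifold such that, with the Riemannian distance $d_g$, $(\mathcal{M},d_g)$ is a complete separable metric space. $X=(X_1,\dots,X_d)\in\mathbb{R}^d$ is a random vector with independent components, $f:\mathbb{R}^d\to\mathcal{M}$ is continuous, and $Z=f(X_1,\dots,X_d)$. The law of $Z$ has a density with respect to the volume measure of $\mathcal{M}$, and two independent copies of $Z$ are, with probability one, joined by a unique minimizing geodesic. For $p,q\in\mathcal{M}$ joined by a unique minimizing geodesic, $B_{pq}$ denotes the closed ball whose center is the midpoint of that geodesic and whose radius is $d_g(p,q)/2$, and $h_{p,q}:\mathcal{M}\to\{0,1\}$ is the indicator function of $B_{pq}$. Fix $\nu\subset\{1,\dots,d\}$, and let $X_\nu=(X_i)_{i\in\nu}$. With $Z_1,Z_2$ independent copies of $Z$, independent of $X$, define $$S^{\nu}_{2}=\mathbb{E}_{Z_1,Z_2}\left[\mathrm{Var}_{X_\nu}\left\{\mathbb{E}_Z\left[h_{Z_1,Z_2}(Z)\mid X_\nu\right]\right\}\right],$$ where for fixed values of $Z_1,Z_2$ the inner conditional expectation and variance are with respect to $X$ (and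 $Z=f(X)$), and the outer expectation is over $(Z_1,Z_2)$. Pick-Freeze: let $X'$ be an independent copy of $X$, and let $X^{\nu}$ be the random vector whose components with index in $\nu$ are those of $X$ and whose components with index in $\{1,\dots,d\}\setminus\nu$ are those of $X'$. Set $Z^{\nu}=f(X^{\nu})$. Sample: $(Z_j,Z_j^{\nu})$, $j=1,\dots,N$, are independent copies of $(Z,Z^{\nu})$, and $W_1,\dots,W_N$ are independent copies of $Z$, independent of the $(Z_j,Z_j^{\nu})$. Let $\mathcal{P}_{N,2}=\{(k_1,k_2)\in\{1,\dots,N\}^2: k_1<k_2\}$ and, for $\tau=(k_1,k_2)\in\mathcal{P}_{N,2}$, write $\mathbf{W}_\tau=(W_{k_1},W_{k_2})$ and $h_{\mathbf{W}_\tau}=h_{W_{k_1},W_{k_2}}$. Estimator: $$\hat S^{\nu}_{2}=\frac{1}{\binom{N}{2}}\sum_{\tau\in\mathcal{P}_{N,2}}\left\{\frac1N\sum_{j=1}^N h_{\mathbf{W}_\tau}(Z_j)\,h_{\mathbf{W}_\tau}(Z_j^{\nu})-\left(\frac{1}{2N}\sum_{j=1}^N\left[h_{\mathbf{W}_\tau}(Z_j)+h_{\mathbf{W}_\tau}(Z_j^{\nu})\right]\right)^2\right\}.$$ *)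

(* Defs.v *)
(* Setting: MathComp-Analysis, over an arbitrary [R : realType]. *)
From HB Require Import structures.
From mathcomp Require Import all_boot all_order all_algebra.
From mathcomp Require Import all_classical all_reals all_analysis.
From mathcomp Require Import measurable_realfun.
Set Implicit Arguments.
Unset Strict Implicit.
Unset Printing Implicit Defensive.
Import Order.TTheory GRing.Theory Num.Theory.
Import numFieldNormedType.Exports.
Local Open Scope classical_set_scope.
Local Open Scope ring_scope.

#[short(type="completeMetricType")]
HB.structure Definition CompleteMetric (R : realType) :=
  {T of Metric R T & Complete T}.

Definition separable_space (T : topologicalType) : Prop :=
  exists2 D : set T, countable D & dense D.

Notation borel T := (g_sigma_algebraType (@open T)).

(** * Riemannian manifolds *)

Section smooth_functions.
Context {R : realType} {n : nat}.

Definition iter_partial (s : seq 'I_n) (f : 'rV[R]_n -> R) : 'rV[R]_n -> R :=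
  foldr (fun i g => 'D_(delta_mx 0 i) g) f s.

(* C^infty on an open set: all iterated partial derivatives exist and are
   continuous there. *)
Definition smooth_on (U : set 'rV[R]_n) (f : 'rV[R]_n -> R) : Prop :=
  forall (s : seq 'I_n) x, U x ->
    {for x, continuous (iter_partial s f)} /\
    forall i, derivable (iter_partial s f) x (delta_mx 0 i).

End smooth_functions.

(* A homeomorphism from an open subset of M onto an open subset of R^n; both
   maps are total functions with irrelevant values outside of their domains. *)
Record chart (R : realType) (M : topologicalType) (n : nat) := Chart {
  chart_dom : set M;
  chart_cod : set 'rV[R]_n;
  chart_map : M -> 'rV[R]_n;
  chart_inv : 'rV[R]_n -> M;
  chart_dom_open : open chart_dom;
  chart_cod_open : open chart_cod;
  chart_map_cod : forall p, chart_dom p -> chart_cod (chart_map p);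
  chart_inv_dom : forall x, chart_cod x -> chart_dom (chart_inv x);
  chart_mapK : forall p, chart_dom p -> chart_inv (chart_map p) = p;
  chart_invK : forall x, chart_cod x -> chart_map (chart_inv x) = x;
  chart_map_continuous :
    forall p, chart_dom p -> {for p, continuous chart_map};
  chart_inv_continuous :
    forall x, chart_cod x -> {for x, continuous chart_inv}
}.

Section transition.
Context {R : realType} {M : topologicalType} {n : nat}.
Variables a b : chart R M n.

Definition transition : 'rV[R]_n -> 'rV[R]_n := chart_map b \o chart_inv a.

Definition transition_dom : set 'rV[R]_n :=
  chart_cod a `&` chart_inv a @^-1` chart_dom b.

End transition.

(* A smooth oriented atlas of dimension n on M with a smooth Riemannian metric,
   given by its Gram matrices in the charts.  Vectors are rows, so that
   ['J f x] acts on the right and pulling back a Gram matrix G along f gives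
   ['J f x *m G *m ('J f x)^T].  When M is a metric space whose distance is the
   Riemannian distance, its topology is that of the manifold, so the charts are
   homeomorphisms for the metric topology. *)
Record oriented_riemannian_structure (R : realType) (M : topologicalType)
    (n : nat) := OrientedRiemannianStructure {
  atlas_index : Type;
  atlas : atlas_index -> chart R M n;
  metric_mx : atlas_index -> 'rV[R]_n -> 'M[R]_n;
  atlas_cover : forall p : M, exists i, chart_dom (atlas i) p;
  atlas_smooth : forall i j (k : 'I_n),
    smooth_on (transition_dom (atlas i) (atlas j))
      (fun x => transition (atlas i) (atlas j) x 0 k);
  atlas_oriented : forall i j x, transition_dom (atlas i) (atlas j) x ->
    0 < \det ('J (transition (atlas i) (atlas j)) x);
  metric_smooth : forall i (k l : 'I_n),
    smooth_on (chart_cod (atlas i)) (fun x => metric_mx i x k l);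
  metric_sym : forall i x, chart_cod (atlas i) x ->
    (metric_mx i x)^T = metric_mx i x;
  metric_posdef : forall i x (v : 'rV[R]_n), chart_cod (atlas i) x ->
    v != 0 -> 0 < (v *m metric_mx i x *m v^T) 0 0;
  metric_compat : forall i j x, transition_dom (atlas i) (atlas j) x ->
    metric_mx i x =
      'J (transition (atlas i) (atlas j)) x
        *m metric_mx j (transition (atlas i) (atlas j) x)
        *m ('J (transition (atlas i) (atlas j)) x)^T
}.

Section riemannian_distance.
Context {R : realType} {M : topologicalType} {n : nat}.
Variable g : oriented_riemannian_structure R M n.

(* [c] is the coordinate expression, in the chart i, of a C^1 arc parametrized
   by [0, 1].  A function is C^1 on [0, 1] (one-sidedly at the endpoints) if
   and only if it is the restriction of a C^1 function on R, which is why [c]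
   is taken C^1 on R. *)
Definition C1_arc (i : atlas_index g) (c : R -> 'rV[R]_n) : Prop :=
  [/\ forall t, derivable c t 1, continuous (derive1 c) &
      forall t, 0 <= t <= 1 -> chart_cod (atlas i) (c t)].

Definition arc_length (i : atlas_index g) (c : R -> 'rV[R]_n) : R :=
  \int[lebesgue_measure]_(t in `[0, 1])
    Num.sqrt ((derive1 c t *m metric_mx i (c t) *m (derive1 c t)^T) 0 0).

(* [piecewise_C1 p q L]: there is a piecewise C^1 curve of length L from p to
   q, namely a finite concatenation of C^1 arcs each lying in one chart. *)
Inductive piecewise_C1 : M -> M -> R -> Prop :=
| piecewise_C1_nil p : piecewise_C1 p p 0
| piecewise_C1_cons i c q L :
    C1_arc i c -> piecewise_C1 (chart_inv (atlas i) (c 1)) q L ->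
    piecewise_C1 (chart_inv (atlas i) (c 0)) q (arc_length i c + L).

Definition riemannian_distance (p q : M) : R :=
  inf [set L | piecewise_C1 p q L].

End riemannian_distance.

Section volume.
Context {R : realType} {M : ptopologicalType} {n : nat}.
Variable g : oriented_riemannian_structure R M n.

Definition is_lebesgue_measure_rV
    (leb : {measure set (borel 'rV[R]_n) -> \bar R}) : Prop :=
  forall a b : 'rV[R]_n, (forall k, a 0 k <= b 0 k) ->
    leb [set x | forall k, a 0 k <= x 0 k <= b 0 k] =
      (\prod_(k < n) (b 0 k - a 0 k))%:E.

(* In every chart the volume measure has density sqrt(det g) with respect to
   the Lebesgue measure of R^n. *)
Definition is_volume_measure (vol : {measure set (borel M) -> \bar R}) : Prop :=
  exists2 leb : {measure set (borel 'rV[R]_n) -> \bar R},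
    is_lebesgue_measure_rV leb &
    forall (i : atlas_index g) (A : set (borel M)), measurable A ->
      A `<=` chart_dom (atlas i) ->
      vol A = (\int[leb]_(x in chart_map (atlas i) @` A)
                 (Num.sqrt (\det (metric_mx i x)))%:E)%E.

End volume.

(** * Minimizing geodesics and the balls B_pq *)

Section balls.
Context {R : realType} {M : metricType R}.

(* Minimizing geodesics are parametrized by [0, 1] with constant speed: they
   are the curves that realize the distance between any two of their points. *)
Definition minimizing_geodesic (p q : M) (gam : R -> M) : Prop :=
  [/\ gam 0 = p, gam 1 = q &
      forall s t, 0 <= s <= 1 -> 0 <= t <= 1 ->
        mdist (gam s) (gam t) = `|s - t| * mdist p q].

Definition unique_minimizing_geodesic (p q : M) (gam : R -> M) : Prop :=
  minimizing_geodesic p q gam /\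
  forall gam', minimizing_geodesic p q gam' ->
    forall t, 0 <= t <= 1 -> gam' t = gam t.

(* The ball is empty, by convention, when p and q are not joined by a unique
   minimizing geodesic. *)
Definition geodesic_ball (p q : M) : set M :=
  [set z | exists2 gam, unique_minimizing_geodesic p q gam &
           mdist (gam (1 / 2)) z <= mdist p q / 2].

Definition ball_ind (p q : M) : M -> R := \1_(geodesic_ball p q).

End balls.

(** * Independence and conditional expectation *)

Section independence.
Context {d : measure_display} {T : measurableType d} {R : realType}.
Variable P : probability T R.

(* The sigma-algebra generated by the X_i, i in D. *)
Definition sigma_of d1 (T1 : measurableType d1) (I : Type) (D : set I)
    (X : I -> T -> T1) : set (set T) :=
  <<s [set E | exists i (A : set T1),
         [/\ D i, measurable A & E = X i @^-1` A] ]>>.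

Definition mutually_independent d1 (T1 : measurableType d1) (I : finType)
    (X : I -> T -> T1) : Prop :=
  forall (J : {set I}) (A : I -> set T1), (forall i, measurable (A i)) ->
    P (\bigcap_(i in [set` J]) X i @^-1` A i) =
      (\prod_(i in J) P (X i @^-1` A i))%E.

Definition independent_families
    d1 (T1 : measurableType d1) (I : Type) (X : I -> T -> T1)
    d2 (T2 : measurableType d2) (K : Type) (Y : K -> T -> T2) : Prop :=
  forall A B, sigma_of setT X A -> sigma_of setT Y B ->
    P (A `&` B) = (P A * P B)%E.

Definition is_cond_exp (G : set (set T)) (Y E : T -> R) : Prop :=
  [/\ forall B : set R, measurable B -> G (E @^-1` B),
      P.-integrable setT (EFin \o E) &
      forall A, G A -> (\int[P]_(x in A) (E x)%:E = \int[P]_(x in A) (Y x)%:E)%E].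

(* A version of E[Y | G], which is unique up to almost sure equality. *)
Definition cond_exp (G : set (set T)) (Y : T -> R) : T -> R :=
  xget (cst 0) [set E | is_cond_exp G Y E].

End independence.

(** * The ball sensitivity numerator and its estimator *)

Section sensitivity.
Context {R : realType} {M : metricType R} {dim : nat}.
Context {d : measure_display} {T : measurableType d}.
Variables (P : probability T R) (X : 'I_dim -> {RV P >-> R}).
Variables (f : 'rV[R]_dim -> M) (nu : {set 'I_dim}).

Definition random_vector (w : T) : 'rV[R]_dim := \row_i X i w.

Definition output (w : T) : M := f (random_vector w).

(* E[h_{z1,z2}(Z) | X_nu] for fixed z1 and z2. *)
Definition cond_ball_prob (z1 z2 : M) : T -> R :=
  cond_exp P (sigma_of [set` nu] X) (fun w => ball_ind z1 z2 (output w)).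

(* The independent copies Z_1 and Z_2 of Z are realized on the product space
   as [output w.1] and [output w.2]. *)
Definition ball_sensitivity : R :=
  fine ('E_(P \x P)[fun w : T * T =>
          fine 'V_P[cond_ball_prob (output w.1) (output w.2)]])%E.

Definition freeze (x x' : 'rV[R]_dim) : 'rV[R]_dim :=
  \row_i (if i \in nu then x 0 i else x' 0 i).

(* The pair (Z, Z^nu); X and its independent copy X' are realized on the
   product space as the random vectors of w.1 and of w.2. *)
Definition pick_freeze_pair (w : T * T) : M * M :=
  (output w.1, f (freeze (random_vector w.1) (random_vector w.2))).

End sensitivity.

Section estimator.
Context {R : realType} {M : metricType R}.

Definition pick_freeze_estimator (N : nat) (Z Znu W : 'I_N -> M) : R :=
  'C(N, 2)%:R^-1 *
  \sum_(tau : 'I_N * 'I_N | (tau.1 < tau.2)%N)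
    (let h := ball_ind (W tau.1) (W tau.2) in
     N%:R^-1 * (\sum_(j < N) h (Z j) * h (Znu j)) -
     ((2 * N%:R)^-1 * \sum_(j < N) (h (Z j) + h (Znu j))) ^+ 2).

End estimator.

(* Main.v *)
Require Import Defs.
From mathcomp Require Import all_boot all_order all_algebra.
From mathcomp Require Import all_classical all_reals all_analysis.
From mathcomp Require Import measurable_realfun.
From mathcomp Require Import ring lra.
Set Implicit Arguments.
Unset Strict Implicit.
Unset Printing Implicit Defensive.
Import Order.TTheory GRing.Theory Num.Theory.
Import numFieldNormedType.Exports.
Local Open Scope classical_set_scope.
Local Open Scope ring_scope.

(** The estimator is a function of 2N independent blocks: the N pairs
(Z_j, Z_j^nu) and the N points W_k.  Its values change by at most 4/N when one
block is replaced: a pair enters each of the averages with weight 1/N, and a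
point W_k occurs in only N - 1 of the N(N-1)/2 balls.  A bounded differences
inequality ([bounded_differences_upper]) therefore gives Gaussian concentration
around its mean at the scale N^(-1/2), for all balls at the same time and with
no union bound.

The mean is within 1/N of the sensitivity numerator ([mean_stat]).  For a fixed
ball with indicator h, the pick-freeze identity
  Var(E[h(Z) | X_nu]) = E[h(Z) h(Z^nu)] - (E h(Z))^2
([variance_cond_exp]) shows that the only bias is the variance of the empirical
mean that is squared in the estimator ([mean_square_average]).  So for N large
the deviation s leaves s/2 to the concentration inequality, which then yields
2 exp(-N s^2 / 512), better than the bound 16 exp(-N s^2 / 648) to be proved.
This is done for s < 2; a deviation above 2 cannot occur, because the
estimator and its target lie in [-1, 1].

Independence enters through one fact ([resample_same_law]): replacing some
coordinates of an independent family by those of an independent copy does not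
change its law.  The pick-freeze construction, the averaging operators behind
the bounded differences inequality, and the splitting of the sample into balls
and pairs are all instances of it.

All of this requires the event to be measurable, hence the set of (p, q, z)
with z in B_pq to be measurable ([measurable_geodesic_ball]).  Charts make M
locally compact, and with separability M is exhausted by compact sets.
Geodesics inside a fixed compact set form a compact set for pointwise
convergence, so that the existence of a minimizing geodesic whose ball contains
z, and the existence of two different geodesics, are both countable unions of
closed conditions on the endpoints and on z. *)

(** * Bounded measurable functions *)

Definition bounded_measurable d (T : measurableType d) (R : realType)
    (g : T -> R) : Prop :=
  measurable_fun setT g /\ exists b, forall x, `|g x| <= b.

Section bounded_measurable.
Context {d : measure_display} {T : measurableType d} {R : realType}.
Implicit Types f g : T -> R.

Lemma bmf_cst (r : R) : bounded_measurable (fun _ : T => r).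
Proof. by split=> //; exists `|r|. Qed.

Lemma bmfD f g : bounded_measurable f -> bounded_measurable g ->
  bounded_measurable (fun x => f x + g x).
Proof.
move=> [mf [a fa]] [mg [b gb]]; split; first exact: measurable_funD.
by exists (a + b) => x; rewrite (le_trans (ler_normD _ _))// lerD.
Qed.

Lemma bmfM f g : bounded_measurable f -> bounded_measurable g ->
  bounded_measurable (fun x => f x * g x).
Proof.
move=> [mf [a fa]] [mg [b gb]]; split; first exact: measurable_funM.
by exists (a * b) => x; rewrite normrM ler_pM.
Qed.

Lemma bmfZ (r : R) f : bounded_measurable f -> bounded_measurable (fun x => r * f x).
Proof. by apply: bmfM; exact: bmf_cst. Qed.

Lemma bmfB f g : bounded_measurable f -> bounded_measurable g ->
  bounded_measurable (fun x => f x - g x).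
Proof.
move=> bf bg; rewrite (_ : (fun x => _) = (fun x => f x + -1 * g x)).
  by apply: bmfD => //; exact: bmfZ.
by apply/funext => x; rewrite mulN1r.
Qed.

Lemma bmfX f n : bounded_measurable f -> bounded_measurable (fun x => f x ^+ n).
Proof.
move=> bf; elim: n => [|n IH].
  by under eq_fun do rewrite expr0; exact: bmf_cst.
by under eq_fun do rewrite exprS; exact: bmfM.
Qed.

Lemma bmf_sum (I : Type) (s : seq I) (p : pred I) (F : I -> T -> R) :
  (forall i, bounded_measurable (F i)) ->
  bounded_measurable (fun x => \sum_(i <- s | p i) F i x).
Proof.
move=> bF; elim: s => [|i s IH].
  by under eq_fun do rewrite big_nil; exact: bmf_cst.
under eq_fun do rewrite big_cons; case: (p i) => //.
exact: bmfD.
Qed.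

Lemma bmf_expR f : bounded_measurable f ->
  bounded_measurable (fun x => expR (f x)).
Proof.
move=> [mf [a fa]]; split; first exact: measurableT_comp.
exists (expR a) => x; rewrite ger0_norm ?expR_ge0// ler_expR.
exact: le_trans (ler_norm _) (fa x).
Qed.

Lemma bmf_comp d' (T' : measurableType d') (phi : T' -> T) f :
  measurable_fun setT phi -> bounded_measurable f ->
  bounded_measurable (fun x => f (phi x)).
Proof.
by move=> mphi [mf [a fa]]; split; [exact: measurableT_comp|exists a].
Qed.

Lemma bmf_indic (A : set T) : measurable A ->
  bounded_measurable (\1_A : T -> R).
Proof.
move=> mA; split; first exact: measurable_indic.
by exists 1 => x; rewrite indicE; case: (_ \in _); rewrite ?normr1 ?normr0.
Qed.

Variable P : probability T R.

Lemma bmf_integrable f : bounded_measurable f ->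
  P.-integrable setT (EFin \o f).
Proof.
move=> [mf [a fa]]; apply: measurable_bounded_integrable => //.
  by rewrite (le_lt_trans (probability_le1 P measurableT))// ltry.
exists a; split; first exact: num_real.
by move=> x ax y _ /=; rewrite (le_trans (fa y))// ltW.
Qed.

Lemma EFin_mean f : bounded_measurable f ->
  ((\int[P]_x f x)%:E = \int[P]_x (f x)%:E)%E.
Proof.
by move=> bf; rewrite /Rintegral fineK//; apply/integrable_fin_num => //;
  exact: bmf_integrable.
Qed.

Lemma mean_cst (r : R) : \int[P]_(_ in setT) r = r.
Proof.
rewrite Rintegral_cst// -[RHS]mulr1; congr (_ * _).
by rewrite -[RHS]/(fine 1%E); congr fine; exact: probability_setT.
Qed.

Lemma meanD f g : bounded_measurable f -> bounded_measurable g ->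
  \int[P]_x (f x + g x) = \int[P]_x f x + \int[P]_x g x.
Proof. by move=> bf bg; rewrite RintegralD//; exact: bmf_integrable. Qed.

Lemma meanB f g : bounded_measurable f -> bounded_measurable g ->
  \int[P]_x (f x - g x) = \int[P]_x f x - \int[P]_x g x.
Proof. by move=> bf bg; rewrite RintegralB//; exact: bmf_integrable. Qed.

Lemma meanZ r f : bounded_measurable f ->
  \int[P]_x (r * f x) = r * \int[P]_x f x.
Proof. by move=> bf; rewrite RintegralZl//; exact: bmf_integrable. Qed.

Lemma mean_sum (I : Type) (s : seq I) (p : pred I) (F : I -> T -> R) :
  (forall i, bounded_measurable (F i)) ->
  \int[P]_x (\sum_(i <- s | p i) F i x) = \sum_(i <- s | p i) \int[P]_x F i x.
Proof.
move=> bF; elim: s => [|i s IH].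
  by under eq_Rintegral do rewrite big_nil; rewrite mean_cst big_nil.
under eq_Rintegral do rewrite big_cons; rewrite big_cons; case: (p i) => //.
by rewrite meanD ?IH//; exact: bmf_sum.
Qed.

Lemma le_mean f g : bounded_measurable f -> bounded_measurable g ->
  (forall x, f x <= g x) -> \int[P]_x f x <= \int[P]_x g x.
Proof. by move=> bf bg fg; apply: le_Rintegral => //; exact: bmf_integrable. Qed.

Lemma mean_le_cst f r : bounded_measurable f ->
  (forall x, f x <= r) -> \int[P]_x f x <= r.
Proof.
by move=> bf fr; rewrite -[leRHS]mean_cst; apply: le_mean => //; exact: bmf_cst.
Qed.

Lemma mean_ge_cst f r : bounded_measurable f ->
  (forall x, r <= f x) -> r <= \int[P]_x f x.
Proof.
by move=> bf fr; rewrite -[leLHS]mean_cst; apply: le_mean => //; exact: bmf_cst.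
Qed.

Lemma mean_norm_le f r : bounded_measurable f ->
  (forall x, `|f x| <= r) -> `|\int[P]_x f x| <= r.
Proof.
move=> bf fr; rewrite ler_norml mean_ge_cst ?mean_le_cst// => x.
  exact: le_trans (ler_norm _) (fr x).
by have := fr x; rewrite ler_norml => /andP[].
Qed.

End bounded_measurable.

Section change_of_variables.
Context {d1 d2 d : measure_display} {T1 : measurableType d1}
  {T2 : measurableType d2} {S : measurableType d} {R : realType}.
Variables (P1 : probability T1 R) (P2 : probability T2 R).

Lemma mean_same_law (phi : T1 -> S) (psi : T2 -> S) (g : S -> R) :
  measurable_fun setT phi -> measurable_fun setT psi -> bounded_measurable g ->
  (forall A, measurable A -> P1 (phi @^-1` A) = P2 (psi @^-1` A)) ->
  \int[P1]_x g (phi x) = \int[P2]_x g (psi x).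
Proof.
move=> mphi mpsi bg same; congr fine.
have mg : measurable_fun setT (EFin \o g) by case: bg => ? _; exact/measurable_EFinP.
transitivity (\int[pushforward P1 phi]_y (g y)%:E)%E.
  rewrite integral_pushforward//; exact/bmf_integrable/bmf_comp.
transitivity (\int[pushforward P2 psi]_y (g y)%:E)%E; last first.
  rewrite integral_pushforward//; exact/bmf_integrable/bmf_comp.
by apply: eq_measure_integral => A mA _; exact: same.
Qed.

End change_of_variables.

Section fubini.
Context {d1 d2 : measure_display} {T1 : measurableType d1}
  {T2 : measurableType d2} {R : realType}.
Variables (P1 : probability T1 R) (P2 : probability T2 R).
Variable g : T1 * T2 -> R.
Hypothesis bg : bounded_measurable g.

Lemma bmf_pair1 x : bounded_measurable (fun y => g (x, y)).
Proof. exact: bmf_comp. Qed.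

Let intg : (P1 \x P2)%E.-integrable setT (EFin \o g).
Proof. exact: bmf_integrable. Qed.

Lemma bmf_mean1 : bounded_measurable (fun x => \int[P2]_y g (x, y)).
Proof.
split; last first.
  by case: bg => _ [b gb]; exists b => x; apply: mean_norm_le => //; exact: bmf_pair1.
(* the Dirac mass is an auxiliary measure on the parameters, for which g is
   integrable and Fubini's theorem applies *)
have intd : (dirac (@point T1) \x P2)%E.-integrable setT (EFin \o g).
  exact: (bmf_integrable (dirac (@point T1) \x P2)%E).
apply/measurable_EFinP; have := measurable_fubini_F intd.
apply: eq_measurable_fun => x _ /=.
by rewrite EFin_mean//; exact: bmf_pair1.
Qed.

Lemma mean_prod12 : \int[(P1 \x P2)%E]_z g z = \int[P1]_x \int[P2]_y g (x, y).
Proof.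
rewrite [in LHS]/Rintegral -(integral12_prod_meas1 intg); congr fine.
by apply: eq_integral => x _ /=; rewrite EFin_mean//; exact: bmf_pair1.
Qed.

End fubini.

(** * Resampling part of an independent family *)

Definition box d (E : measurableType d) (I : Type) (A : I -> set E) :
  set (I -> E) := [set y | forall i, A i (y i)].

(** The boxes are stable under intersection and generate the product
sigma-algebra, so that laws of families are determined by their values on
them. *)
Definition boxes d (E : measurableType d) (I : Type) : set (set (I -> E)) :=
  [set box A | A in [set A : I -> set E | forall i, measurable (A i)]].

Notation famType E I := (g_sigma_algebraType (@boxes _ E I)).

Section families.
Context {d : measure_display} {E : measurableType d} {I : finType}.

Lemma measurable_box (A : I -> set E) : (forall i, measurable (A i)) ->
  measurable (box A : set (famType E I)).
Proof. by move=> mA; apply: sub_sigma_algebra; exists A. Qed.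

Lemma measurable_coord i : measurable_fun setT (fun y : famType E I => y i).
Proof.
move=> _ A mA; rewrite setTI.
rewrite (_ : _ @^-1` _ = box (fun j => if j == i then A else setT)).
  by apply: measurable_box => j; case: ifP.
apply/seteqP; split => [y /= Ay j|y /(_ i)/=]; last by rewrite eqxx.
by case: eqVneq => [->|].
Qed.

Lemma measurable_family d' (S : measurableType d') (phi : S -> I -> E) :
  (forall i, measurable_fun setT (fun x => phi x i)) ->
  measurable_fun setT (phi : S -> famType E I).
Proof.
move=> mphi; apply: (@measurability _ _ S (famType E I) setT phi (@boxes _ E I)) => //.
move=> _ [_ [A mA <-] <-]; rewrite setTI.
rewrite (_ : _ @^-1` _ = \bigcap_i ((fun x => phi x i) @^-1` A i)).
  apply: fin_bigcap_measurable => [|i _]; first exact: finite_finset.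
  by rewrite -[X in measurable X]setTI; exact: mphi.
by apply/seteqP; split=> x Ax i; [move=> _; exact: Ax|exact: Ax].
Qed.

Definition mix (J : {set I}) (y y' : I -> E) : famType E I :=
  fun i => if i \in J then y i else y' i.

Lemma measurable_mix J d' (S : measurableType d') (phi psi : S -> famType E I) :
  measurable_fun setT phi -> measurable_fun setT psi ->
  measurable_fun setT (fun x => mix J (phi x) (psi x)).
Proof.
move=> mphi mpsi; apply: measurable_family => i; rewrite /mix.
case: (i \in J); first exact: (measurableT_comp (measurable_coord i) mphi).
exact: (measurableT_comp (measurable_coord i) mpsi).
Qed.

Lemma boxes_setI : setI_closed (@boxes _ E I).
Proof.
move=> _ _ [A mA <-] [B mB <-]; exists (fun i => A i `&` B i).
  by move=> i; exact: measurableI.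
apply/seteqP; split=> [y AB|y [Ay By] i]; last by split.
by split=> i; have [] := AB i.
Qed.

Lemma boxes_setT : @boxes _ E I setT.
Proof. by exists (fun=> setT) => //; apply/seteqP. Qed.

End families.

Section resampling.
Context {d dE : measure_display} {T : measurableType d} {R : realType}
  {E : measurableType dE} {I : finType}.
Variables (P : probability T R) (Y : I -> T -> E).
Hypothesis mY : forall i, measurable_fun setT (Y i).
Hypothesis indepY : mutually_independent P Y.

Let PP : probability (T * T)%type R := (P \x P)%E.

Lemma measurable_sample : measurable_fun setT ((fun w i => Y i w) : T -> famType E I).
Proof. exact: measurable_family. Qed.

Lemma measurable_resample J :
  measurable_fun setT (fun w : T * T => mix J (Y^~ w.1) (Y^~ w.2)).
Proof.
apply: measurable_mix.
- exact: (measurableT_comp measurable_sample measurable_fst).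
- exact: (measurableT_comp measurable_sample measurable_snd).
Qed.

(** By independence both laws give a box the product of the laws of its sides:
the sides in J come from one copy of the family, the others from the second. *)
Lemma resample_same_law (J : {set I}) (A : set (famType E I)) : measurable A ->
  P ((fun w => Y^~ w : famType E I) @^-1` A) =
  PP ((fun w => mix J (Y^~ w.1) (Y^~ w.2)) @^-1` A).
Proof.
move=> mA.
have mS := measurable_sample; have mR := measurable_resample J.
apply: (@measure_unique _ _ (famType E I) (@boxes _ E I) (fun=> setT) _ _ _ _
  (pushforward P (fun w => Y^~ w : famType E I))
  (pushforward PP (fun w => mix J (Y^~ w.1) (Y^~ w.2) : famType E I))) => //.
- exact: boxes_setI.
- by move=> _; exact: boxes_setT.
- by rewrite bigcup_const.
- move=> _ [B mB <-]; rewrite /pushforward.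
  pose cap (K : {set I}) := \bigcap_(i in [set` K]) Y i @^-1` B i.
  have mcap K : measurable (cap K).
    apply: fin_bigcap_measurable => [|i _]; first exact: finite_finset.
    by rewrite -[X in measurable X]setTI; exact: mY.
  have e1 : [set w | box B (Y^~ w)] = cap [set: I]%SET.
    by apply/seteqP; split=> w Bw i; [move=> _|]; apply: Bw => /=; rewrite ?inE.
  have e2 : [set w : T * T | box B (mix J (Y^~ w.1) (Y^~ w.2))] =
      cap J `*` cap (~: J)%SET.
    apply/seteqP; split=> [w Bw|w [/= Bw1 Bw2] i].
      split=> i /= iJ; have := Bw i; rewrite /mix; first by rewrite iJ.
      by move: iJ; rewrite inE => /negbTE ->.
    by rewrite /mix; case: ifPn => iJ; [exact: Bw1|apply: Bw2; rewrite /= inE].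
  transitivity (P [set w | box B (Y^~ w)]) => //.
  transitivity (PP [set w : T * T | box B (mix J (Y^~ w.1) (Y^~ w.2))]) => //.
  rewrite e1 e2.
  transitivity (P (cap J) * P (cap (~: J)%SET))%E; last first.
    by apply/esym; apply: (product_measure1E P P).
  rewrite /cap !indepY//.
  by rewrite (big_setID J) /= finset.setTI finset.setTD.
- by move=> _; rewrite /= /pushforward preimage_setT probability_setT ltry.
Qed.

Lemma mean_resample (J : {set I}) (g : famType E I -> R) : bounded_measurable g ->
  \int[P]_w g (Y^~ w) = \int[P]_w \int[P]_w' g (mix J (Y^~ w) (Y^~ w')).
Proof.
move=> bg.
rewrite (mean_same_law (P1 := P) (P2 := PP) measurable_sample
  (measurable_resample J) bg (resample_same_law J)).
by rewrite mean_prod12//; exact: (bmf_comp (measurable_resample J)).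
Qed.

End resampling.

(** * A bounded differences inequality *)

(** Squaring 1 - x/2 <= exp(-x/2) bounds exp x by (1 - x/2)^-2. *)
Lemma expR_le_quadratic (R : realType) (x : R) : `|x| <= 1 / 4 ->
  expR x <= 1 + x + x ^+ 2.
Proof.
rewrite ler_norml => /andP[x1 x2].
have h : expR x * (1 - x / 2) ^+ 2 <= 1.
  have e1 : expR x * expR (- (x / 2)) ^+ 2 = 1.
    by rewrite expr2 -!expRD [X in expR X](_ : _ = 0) ?expR0//; field.
  rewrite -[leRHS]e1.
  rewrite ler_pM2l ?expR_gt0//; apply: lerXn2r; rewrite ?nnegrE ?expR_ge0//.
    by lra.
  by have := expR_ge1Dx (- (x / 2)); lra.
have a0 : 0 < (1 - x / 2) ^+ 2 by apply: exprn_gt0; lra.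
rewrite -(ler_pM2r a0) (le_trans h)//.
have -> : (1 + x + x ^+ 2) * (1 - x / 2) ^+ 2 =
  1 + x ^+ 2 / 4 * (1 - 3 * x + x ^+ 2) by field.
rewrite lerDl mulr_ge0 ?divr_ge0 ?sqr_ge0//.
have := sqr_ge0 x; lra.
Qed.

(** A weak form of the lemma of Hoeffding: by the quadratic bound for the
exponential, a centred variable of size at most c has a moment generating
function at most 1 + (l c)^2. *)
Lemma mean_expR_le d (T : measurableType d) (R : realType)
    (P : probability T R) (g : T -> R) (c l : R) :
  bounded_measurable g -> (forall w w', `|g w - g w'| <= c) ->
  0 <= l -> l * c <= 1 / 4 ->
  \int[P]_w expR (l * g w) <= expR (l * \int[P]_w g w + l ^+ 2 * c ^+ 2).
Proof.
move=> bg gc l0 lc; set m := \int[P]_w g w.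
have gm w : `|g w - m| <= c.
  have -> : g w - m = \int[P]_w' (g w - g w').
    by rewrite meanB ?mean_cst//; exact: bmf_cst.
  by apply: mean_norm_le => //; apply: bmfB => //; exact: bmf_cst.
have c0 : 0 <= c by apply: le_trans (gc point point).
have bgm : bounded_measurable (fun w => l * (g w - m)).
  by apply/bmfZ/bmfB => //; exact: bmf_cst.
apply: (@le_trans _ _ (\int[P]_w (expR (l * m) *
   (1 + l * (g w - m) + l ^+ 2 * c ^+ 2)))).
  apply: le_mean.
  - by apply/bmf_expR/bmfZ.
  - by apply/bmfZ/bmfD; [apply: bmfD => //; exact: bmf_cst|exact: bmf_cst].
  move=> w; rewrite (_ : l * g w = l * m + l * (g w - m)); last by ring.
  rewrite expRD ler_pM2l ?expR_gt0//.
  have lgm : `|l * (g w - m)| <= l * c by rewrite normrM (ger0_norm l0) ler_wpM2l.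
  apply: le_trans (expR_le_quadratic (le_trans lgm lc)) _.
  rewrite lerD2l -exprMn -[leLHS]real_normK ?num_real//.
  by rewrite ler_pXn2r ?nnegrE ?mulr_ge0.
have bq : bounded_measurable (fun w => 1 + l * (g w - m)).
  by apply: bmfD => //; exact: bmf_cst.
rewrite meanZ; last by apply: bmfD => //; exact: bmf_cst.
rewrite meanD//; last exact: bmf_cst.
rewrite meanD//; last exact: bmf_cst.
rewrite meanZ; last by apply: bmfB => //; exact: bmf_cst.
rewrite meanB//; last exact: bmf_cst.
rewrite !mean_cst -/m subrr mulr0 addr0 expRD ler_pM2l ?expR_gt0//.
exact: expR_ge1Dx.
Qed.

Section bounded_differences.
Context {d dE : measure_display} {T : measurableType d} {R : realType}
  {E : measurableType dE} {I : finType}.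
Variables (P : probability T R) (Y : I -> T -> E).
Hypothesis mY : forall i, measurable_fun setT (Y i).
Hypothesis indepY : mutually_independent P Y.

Definition variation_bound (F : famType E I -> R) (c : I -> R) : Prop :=
  forall k y y', (forall i, i != k -> y i = y' i) -> `|F y - F y'| <= c k.

(** The conditional expectation of F given all coordinates but k, as a function
on the space of families. *)
Definition average (k : I) (F : famType E I -> R) (y : famType E I) : R :=
  \int[P]_w F (mix [set~ k] y (Y^~ w)).

Let replace_bmf k (F : famType E I -> R) : bounded_measurable F ->
  bounded_measurable (fun z : famType E I * T => F (mix [set~ k] z.1 (Y^~ z.2))).
Proof.
move=> bF; apply: (bmf_comp (phi := fun z : famType E I * T =>
  mix [set~ k] z.1 (Y^~ z.2))) => //.
apply: measurable_mix; first exact: measurable_fst.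
exact: (measurableT_comp (measurable_sample mY) measurable_snd).
Qed.

Lemma bmf_average k (F : famType E I -> R) : bounded_measurable F -> bounded_measurable (average k F).
Proof. by move=> bF; exact: (bmf_mean1 P (replace_bmf k bF)). Qed.

Lemma mean_average k (F : famType E I -> R) : bounded_measurable F ->
  \int[P]_w average k F (Y^~ w) = \int[P]_w F (Y^~ w).
Proof. by move=> bF; rewrite [RHS](mean_resample mY indepY [set~ k] bF). Qed.

Lemma variation_average k (F : famType E I -> R) (c : I -> R) : bounded_measurable F ->
  variation_bound F c ->
  variation_bound (average k F) (fun i => if i == k then 0 else c i).
Proof.
move=> bF Fc j y y' yy'.
have bk z : bounded_measurable (fun w => F (mix [set~ k] z (Y^~ w))).
  exact: (bmf_pair1 (replace_bmf k bF)).
rewrite /average -meanB//.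
apply: mean_norm_le => [|w]; first exact: bmfB.
case: eqVneq yy' => [-> yy'|_ yy'].
  rewrite (_ : mix _ y' _ = mix [set~ k] y (Y^~ w)) ?subrr ?normr0//.
  by apply/funext => i; rewrite /mix !inE; case: eqVneq => //= ik; rewrite yy'.
by apply: Fc => i ij; rewrite /mix; case: ifP => // _; exact: yy'.
Qed.

(** Two families are joined by finitely many changes of one coordinate. *)
Lemma variation0_cst F c : variation_bound F c -> (forall k, c k = 0) ->
  forall y y', F y = F y'.
Proof.
move=> Fc c0 y y'.
suff step (s : seq I) : F (fun i => if i \in s then y' i else y i) = F y.
  by rewrite -(step (enum I)); congr F; apply/funext => i; rewrite mem_enum.
elim: s => [|k s <-]; first by congr F.
apply/eqP; rewrite -subr_eq0 -normr_le0 -(c0 k); apply: Fc => i ik.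
by rewrite inE (negbTE ik).
Qed.

(** The one-variable bound applied to coordinate k, the other coordinates being
fixed. *)
Lemma mean_expR_average k (F : famType E I -> R) (c : I -> R) (l : R) : bounded_measurable F ->
  variation_bound F c -> 0 <= l -> l * c k <= 1 / 4 ->
  \int[P]_w expR (l * F (Y^~ w)) <=
  expR (l ^+ 2 * c k ^+ 2) * \int[P]_w expR (l * average k F (Y^~ w)).
Proof.
move=> bF Fc l0 lc.
have be (G : famType E I -> R) : bounded_measurable G -> bounded_measurable (fun y : famType E I => expR (l * G y)).
  by move=> bG; exact/bmf_expR/bmfZ.
have ms := measurable_sample mY.
rewrite (mean_resample mY indepY [set~ k] (be _ bF)).
have bA := be _ (bmf_average k bF).
rewrite -meanZ; last exact: (bmf_comp ms bA).
apply: le_mean.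
- exact: (bmf_comp ms (bmf_mean1 P (replace_bmf k (be _ bF)))).
- exact: (bmfZ _ (bmf_comp ms bA)).
move=> w; rewrite -expRD addrC; apply: mean_expR_le => //.
  exact: (bmf_pair1 (replace_bmf k bF)).
move=> w' w''; apply: Fc => i ik; rewrite /mix !inE ik//.
Qed.

(** The coordinates are averaged out one after the other.  Each step costs a
factor exp(l^2 c^2), keeps the mean, and makes the function insensitive to one
more coordinate; at the end it is constant. *)
Lemma bounded_differences_mgf (F : famType E I -> R) (c l : R) : bounded_measurable F ->
  variation_bound F (fun=> c) -> 0 <= c -> 0 <= l -> l * c <= 1 / 4 ->
  \int[P]_w expR (l * F (Y^~ w)) <=
  expR (l * \int[P]_w F (Y^~ w) + #|I|%:R * (l ^+ 2 * c ^+ 2)).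
Proof.
move=> bF Fc c0 l0 lc.
suff: forall (s : seq I) (G : famType E I -> R) b, uniq s -> bounded_measurable G ->
    variation_bound G b -> (forall k, b k = if k \in s then c else 0) ->
    \int[P]_w expR (l * G (Y^~ w)) <=
    expR (l * \int[P]_w G (Y^~ w) + (size s)%:R * (l ^+ 2 * c ^+ 2)).
  move=> /(_ (enum I) F (fun=> c) (enum_uniq _) bF Fc); rewrite -cardE; apply.
  by move=> k; rewrite mem_enum.
have ms := measurable_sample mY.
elim=> [|k s IH] G b /= + bG Gb bE.
  move=> _; pose v := G (Y^~ point).
  have Gv w : G (Y^~ w) = v by apply: (variation0_cst Gb).
  under eq_Rintegral do rewrite Gv.
  under [in leRHS]eq_Rintegral do rewrite Gv.
  by rewrite !mean_cst mul0r addr0.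
move=> /andP[ks us].
have bk : b k = c by rewrite bE mem_head.
have := @mean_expR_average k G b l bG Gb l0; rewrite bk => /(_ lc) /le_trans; apply.
have := IH _ _ us (bmf_average k bG) (variation_average k bG Gb).
have E1 i : (if i == k then 0 else b i) = if i \in s then c else 0.
  case: eqVneq => [->|ik]; first by rewrite (negbTE ks).
  by rewrite bE inE (negbTE ik).
move=> /(_ E1) h.
apply: le_trans (ler_wpM2l (expR_ge0 _) h) _.
rewrite -expRD mean_average// ler_expR -natr1 mulrDl mul1r.
lra.
Qed.

(** Chernoff's method: the Markov inequality for [expR (l * F)]. *)
Lemma bounded_differences_upper (F : famType E I -> R) (c l e : R) : bounded_measurable F ->
  variation_bound F (fun=> c) -> 0 <= c -> 0 <= l -> l * c <= 1 / 4 ->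
  (P [set w | \int[P]_w' F (Y^~ w') + e < F (Y^~ w)]%R <=
   (expR (#|I|%:R * (l ^+ 2 * c ^+ 2) - l * e))%:E)%E.
Proof.
move=> bF Fc c0 l0 lc; set m := \int[P]_w' _.
have ms := measurable_sample mY.
have bFY := bmf_comp ms bF.
set A := [set w | _].
have mA : measurable A.
  rewrite /A -[X in measurable X]setTI.
  rewrite (_ : [set: T] `&` _ = (fun w => F (Y^~ w)) @^-1` `]m + e, +oo[).
    by rewrite -[X in measurable X]setTI; apply: (bFY.1).
  by rewrite setTI; apply/seteqP; split=> w /=; rewrite in_itv/= andbT.
have -> : P A = (\int[P]_w (\1_A w : R))%:E.
  by rewrite EFin_mean ?integral_indic ?setIT//; exact: bmf_indic.
rewrite lee_fin.
have bexp : bounded_measurable (fun w => expR (l * F (Y^~ w))).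
  exact/bmf_expR/bmfZ.
apply: (@le_trans _ _ (\int[P]_w (expR (- (l * (m + e))) * expR (l * F (Y^~ w))))).
  apply: le_mean; [exact: bmf_indic|exact: bmfZ|] => w.
  rewrite indicE -expRD; case: (boolP (w \in A)) => [|_]; last exact: expR_ge0.
  rewrite inE /A /= => Aw; rewrite -expR0 ler_expR addrC subr_ge0.
  by rewrite ler_wpM2l// ltW.
rewrite meanZ//.
apply: le_trans (ler_wpM2l (expR_ge0 _) (bounded_differences_mgf bF Fc c0 l0 lc)) _.
by rewrite -expRD ler_expR -/m; lra.
Qed.

End bounded_differences.

(** * Open sets of products are product measurable *)

(** The open sets are given as a family [op] rather than by a topology on S
because the measurable type and the topological space are different structures
on the same points. *)
Definition measurable_basis d (S : measurableType d) (op : set (set S)) :=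
  exists B : nat -> set S, (forall n, measurable (B n)) /\
    forall O x, op O -> O x -> exists2 n, B n x & B n `<=` O.

(** For two topologies this is the product topology; the form iterates to
products of products, whose measurable structure is that of pairs of pairs. *)
Definition rect_open (S1 S2 : Type) (op1 : set (set S1)) (op2 : set (set S2)) :
    set (set (S1 * S2)) :=
  [set O | forall z, O z -> exists U V,
     [/\ op1 U, op2 V, U z.1, V z.2 & U `*` V `<=` O]].

Lemma measurable_basis_prod d1 d2 (S1 : measurableType d1)
    (S2 : measurableType d2) op1 op2 :
  measurable_basis op1 -> measurable_basis op2 ->
  @measurable_basis _ (S1 * S2)%type (rect_open op1 op2).
Proof.
move=> [B1 [mB1 HB1]] [B2 [mB2 HB2]].
exists (fun n => if unpickle n is Some ij then B1 ij.1 `*` B2 ij.2 else set0).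
split=> [n|O z Oop Oz].
  by case: (unpickle n) => [ij|]; [exact: measurableX|exact: measurable0].
have [U [V [opU opV Uz Vz UVO]]] := Oop z Oz.
have [i Bi BiU] := HB1 _ _ opU Uz; have [j Bj BjV] := HB2 _ _ opV Vz.
exists (pickle (i, j)); rewrite pickleK//=.
by move=> w [/BiU Uw /BjV Vw]; exact: UVO.
Qed.

(** An open set is the countable union of the basic sets that it contains. *)
Lemma measurable_basis_open d (S : measurableType d) (op : set (set S)) O :
  measurable_basis op -> op O -> measurable O.
Proof.
move=> [B [mB HB]] opO.
rewrite (_ : O = \bigcup_(n in [set n | B n `<=` O]) B n).
  by apply: bigcup_measurable => n _; exact: mB.
apply/seteqP; split=> [x Ox|x [n /= BnO Bn]]; last exact: BnO.
by have [n Bn BnO] := HB _ _ opO Ox; exists n.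
Qed.

Lemma open_rect_open (T1 T2 : topologicalType) (O : set (T1 * T2)) :
  open O -> rect_open open open O.
Proof.
move=> oO z Oz; have : nbhs z O by exact: open_nbhs_nbhs.
move=> [[A B] /= [zA zB] ABO].
exists A^°, B^°; split; [exact: open_interior|exact: open_interior| | |].
- exact: zA.
- exact: zB.
- by move=> w [/= /interior_subset Aw /interior_subset Bw]; apply: ABO.
Qed.

Lemma rect_openS (S1 S2 : Type) (op1 op1' : set (set S1)) (op2 : set (set S2)) :
  op1 `<=` op1' -> rect_open op1 op2 `<=` rect_open op1' op2.
Proof.
move=> h O oO z /oO[U [V [oU oV Uz Vz UVO]]]; exists U, V; split=> //; exact: h.
Qed.

Lemma hausdorff_prod (T1 T2 : topologicalType) :
  hausdorff_space T1 -> hausdorff_space T2 -> hausdorff_space (T1 * T2)%type.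
Proof.
move=> h1 h2 [a b] [c d] cl; congr (_, _).
- apply: h1 => A B aA cB.
  have [||z [[/= Az _] [/= Bz _]]] := cl (A `*` setT) (B `*` setT); last by exists z.1.
  + by exists (A, setT) => //; split => //=; exact: filterT.
  + by exists (B, setT) => //; split => //=; exact: filterT.
- apply: h2 => A B aA cB.
  have [||z [[/= _ Az] [/= _ Bz]]] := cl (setT `*` A) (setT `*` B); last by exists z.2.
  + by exists (setT, A) => //; split => //=; exact: filterT.
  + by exists (setT, B) => //; split => //=; exact: filterT.
Qed.

Section metric.
Context {R : realType} {M : metricType R}.

Lemma mdist_continuous : continuous (fun z : M * M => mdist z.1 z.2).
Proof.
move=> z; apply/cvgrPdist_lt => e e0.
have e2 : 0 < e / 2 by rewrite divr_gt0.
near=> w.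
have h1 : mdist z.1 w.1 < e / 2.
  have : ball z.1 (e / 2) w.1.
    near: w; apply: (@cvg_fst _ _ (nbhs z.1) (nbhs z.2)); exact: nbhsx_ballx.
  by rewrite ballEmdist.
have h2 : mdist z.2 w.2 < e / 2.
  have : ball z.2 (e / 2) w.2.
    near: w; apply: (@cvg_snd _ _ (nbhs z.1) (nbhs z.2)); exact: nbhsx_ballx.
  by rewrite ballEmdist.
have t1 := metric_triangle z.1 w.1 z.2; have t2 := metric_triangle w.1 w.2 z.2.
have t3 := metric_triangle w.1 z.1 w.2; have t4 := metric_triangle z.1 z.2 w.2.
rewrite (metric_sym w.2 z.2) in t2; rewrite (metric_sym w.1 z.1) in t3.
rewrite ltr_norml; apply/andP; split; lra.
Unshelve. all: by end_near. Qed.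

Lemma continuous_mdist (U : topologicalType) (f h : U -> M) :
  continuous f -> continuous h -> continuous (fun u => mdist (f u) (h u)).
Proof.
move=> cf ch u.
apply: (@continuous_comp _ _ _ (fun u => (f u, h u)) (fun z => mdist z.1 z.2)).
  exact: (cvg_pair (cf u) (ch u)).
exact: mdist_continuous.
Qed.

End metric.

Lemma closed_le_continuous (R : realType) (U : topologicalType) (f h : U -> R) :
  continuous f -> continuous h -> closed [set u | f u <= h u].
Proof.
move=> cf ch.
rewrite (_ : [set u | _] = (fun u => f u - h u) @^-1` [set x | x <= 0]).
  apply: closed_comp => [u _|]; last exact: closed_le.
  by apply: continuousB; [exact: cf|exact: ch].
by apply/seteqP; split=> u /=; rewrite subr_le0.
Qed.

Lemma continuous_mul (R : realType) (U : topologicalType) (f h : U -> R) :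
  continuous f -> continuous h -> continuous (fun u => f u * h u).
Proof. by move=> cf ch u; apply: continuousM; [exact: cf|exact: ch]. Qed.

Lemma continuous_const (T U : topologicalType) (r : U) :
  continuous (fun _ : T => r).
Proof. by move=> u; exact: cvg_cst. Qed.

Lemma continuous_pair (U V W : topologicalType) (f : U -> V) (h : U -> W) :
  continuous f -> continuous h -> continuous (fun u => (f u, h u)).
Proof. by move=> cf ch u; apply: cvg_pair; [exact: cf|exact: ch]. Qed.

Lemma continuous_snd (U V : topologicalType) : continuous (@snd U V).
Proof. by move=> u; exact: cvg_snd. Qed.

Lemma image_compact (T U : topologicalType) (f : T -> U) (A : set T) :
  continuous f -> compact A -> compact (f @` A).
Proof. by move=> cf cA; apply: continuous_compact => //; exact: continuous_subspaceT. Qed.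

(** * Compact exhaustion *)

Section exhaustion.
Context {R : realType} {M : completeMetricType R}.

Let mdist_triangle (x y z : M) : mdist x z <= mdist x y + mdist y z.
Proof. exact: metric_triangle. Qed.

Let mdist_sym (x y : M) : mdist x y = mdist y x.
Proof. exact: metric_sym. Qed.

(** A compact neighbourhood is the image of a small closed cube in a chart. *)
Lemma locally_compact_manifold n (g : oriented_riemannian_structure R M n)
  (p : M) : exists2 K, compact K & nbhs p K.
Proof.
have [i] := atlas_cover g p; set c := atlas i => pc.
set x := chart_map c p.
have xc : chart_cod c x by exact: chart_map_cod.
have /nbhs_ballP[e /= e0 xe] : nbhs x (chart_cod c).
  by apply: open_nbhs_nbhs; split => //; exact: chart_cod_open.
pose Kx : set 'rV[R]_n := [set v | forall k, [set` `[x 0 k - e / 2, x 0 k + e / 2]] (v 0 k)].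
have cKx : compact Kx.
  apply: (@rV_compact R n (fun k => [set` `[x 0 k - e / 2, x 0 k + e / 2]])) => k.
  exact: segment_compact.
have Kxc : Kx `<=` chart_cod c.
  move=> v vK; apply: xe; split=> // a k; rewrite (ord1 a) /ball /=.
  have := vK k; rewrite /= in_itv /= => /andP[v1 v2].
  by rewrite ltr_norml; apply/andP; split; lra.
exists (chart_inv c @` Kx).
  apply: continuous_compact => //; apply: continuous_in_subspaceT => v.
  by rewrite inE => /Kxc; exact: chart_inv_continuous.
have xKx : nbhs x Kx.
  apply/nbhs_ballP; exists (e / 2); first by rewrite /= divr_gt0.
  move=> v [_ vx] k; have := vx 0 k; rewrite /ball /= in_itv /= ltr_norml.
  by move=> /andP[v1 v2]; apply/andP; split; lra.
have h1 : nbhs p (chart_dom c) by apply: open_nbhs_nbhs; split => //; exact: chart_dom_open.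
have h2 : nbhs p (chart_map c @^-1` Kx) by exact: (chart_map_continuous pc).
apply: filterS (filterI h1 h2) => q [qc qK].
by exists (chart_map c q) => //; exact: chart_mapK.
Qed.

Hypothesis lcM : forall p : M, exists2 K, compact K & nbhs p K.
Hypothesis Msep : separable_space M.

Lemma dense_seq : exists e : nat -> M,
  forall (p : M) (r : R), 0 < r -> exists n, mdist p (e n) < r.
Proof.
have [D cD dD] := Msep.
have /pcard_geP[e] := cD.
exists e => p r r0.
have [q [qB Dq]] : ball p r `&` D !=set0.
  have [q [qB Dq]] : (ball p r)^° `&` D !=set0.
    apply: dD; last exact: open_interior.
    by exists p; exact: nbhsx_ballx.
  by exists q; split => //; exact: interior_subset.
have [k _ ek] := @surj _ _ _ _ e q Dq.
by exists k; rewrite ek; move: qB; rewrite ballEmdist.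
Qed.

Lemma inv_succ_lt (r : R) : 0 < r -> exists k : nat, k.+1%:R^-1 < r.
Proof.
move=> r0; exists (Num.truncn r^-1).
by rewrite invf_plt ?posrE// truncnS_gt.
Qed.

Lemma borel_basis : @measurable_basis _ (borel M) (@open M).
Proof.
have [e eP] := dense_seq.
exists (fun n => if unpickle n is Some ik
  then (ball (e ik.1) (ik.2.+1%:R^-1 : R))^° else set0).
split=> [n|O x oO Ox].
  case: (unpickle n) => [ik|]; last exact: measurable0.
  by apply: sub_sigma_algebra; exact: open_interior.
have /nbhs_ballP[r /= r0 rO] : nbhs x O by exact: open_nbhs_nbhs.
have [k kr] := inv_succ_lt (divr_gt0 r0 (ltr0n R 2)).
have k0 : 0 < k.+1%:R^-1 :> R by rewrite invr_gt0.
have [i ix] := eP x _ k0.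
exists (pickle (i, k)); rewrite pickleK /=.
  have -> : (ball (e i) (k.+1%:R^-1 : R))^° = ball (e i) (k.+1%:R^-1 : R).
    apply/interior_id; rewrite openE => y; rewrite ballEmdist /= => ey.
    apply/nbhs_ballP; exists (k.+1%:R^-1 - mdist (e i) y).
      by rewrite /= subr_gt0.
    move=> z; rewrite ballEmdist /= => yz.
    by apply: le_lt_trans (mdist_triangle _ y _) _; rewrite addrC -ltrBrDr.
  by rewrite ballEmdist /= mdist_sym.
move=> y /interior_subset; rewrite ballEmdist /= => ey.
apply: rO; rewrite ballEmdist /=.
apply: le_lt_trans (mdist_triangle _ (e i) _) _.
by rewrite (splitr r) ltrD// (lt_trans _ kr).
Qed.

(** The compact balls with radius 1/(k+1) centred at a dense sequence have
interiors that cover M; K n is the union of the first n of them. *)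
Lemma compact_exhaustion : exists K : nat -> set M,
  [/\ forall n, compact (K n), forall m n, (m <= n)%N -> K m `<=` K n &
      forall C, compact C -> exists n, C `<=` K n].
Proof.
have [e eP] := dense_seq.
pose cb i k : set M := [set y | mdist (e i) y <= k.+1%:R^-1].
pose C n := if unpickle n is Some ik
  then (if `[< compact (cb ik.1 ik.2) >] then cb ik.1 ik.2 else set0) else set0.
have cC n : compact (C n).
  rewrite /C; case: (unpickle n) => [ik|]; last exact: compact0.
  by case: ifPn => [/asboolP //|_]; exact: compact0.
have nC (p : M) : exists n, nbhs p (C n).
  have [Kp cKp /nbhs_ballP[r /= r0 rK]] := lcM p.
  have [k kr] := inv_succ_lt (divr_gt0 r0 (ltr0n R 2)).
  have k0 : 0 < k.+1%:R^-1 :> R by rewrite invr_gt0.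
  have [i ix] := eP p _ k0.
  exists (pickle (i, k)); rewrite /C pickleK /=.
  case: ifPn => [_|/asboolP[]]; last first.
    apply: (subclosed_compact _ cKp).
      apply: (@closed_le_continuous _ _ (fun y : M => mdist (e i) y)
        (fun=> k.+1%:R^-1)) => y; last exact: cvg_cst.
      by apply: (@continuous_mdist _ _ _ (fun=> e i) id) => z //; exact: cvg_cst.
    move=> y; rewrite /cb /= => ey; apply: rK; rewrite ballEmdist /=.
    apply: le_lt_trans (mdist_triangle _ (e i) _) _.
    by rewrite (splitr r) ltrD ?(lt_trans ix kr) ?(le_lt_trans ey kr).
  apply/nbhs_ballP; exists (k.+1%:R^-1 - mdist p (e i)); first by rewrite /= subr_gt0.
  move=> y; rewrite ballEmdist /cb /= => py.
  apply: le_trans (mdist_triangle _ p _) _.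
  by rewrite (mdist_sym _ p) addrC -lerBrDr ltW.
exists (fun n => \bigcup_(i < n) C i); split.
- by move=> n; rewrite bigcup_mkord; apply: bigsetU_compact.
- by move=> m n mn x [i /= im Cx]; exists i => //=; exact: leq_trans mn.
- move=> A /compact_near_coveringP cA.
  have [|N _ HN] := @cA nat \oo (fun n x => (\bigcup_(i < n) C i) x) _.
    move=> x Ax; have [m xm] := nC x.
    exists (C m, [set n | (m < n)%N]) => /=.
      by split => //; exists m.+1.
    by move=> [y n] [/= Cy mn]; exists m.
  by exists N; exact: (HN N (leqnn N)).
Qed.

End exhaustion.

(** * The balls are jointly measurable *)

Section geodesics.
Context {R : realType} {M : completeMetricType R}.

(** Pointwise convergence makes evaluations continuous and Tychonoff's theorem
available; constant speed is a condition on pairs of times, hence closed. *)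
Definition path_space := prod_topology (fun _ : R => M).

(** The constraint K bears on all times, including those outside [0, 1], so that
the set is compact; geodesics are extended by constants ([clamp]). *)
Definition geodesics_in (K : set M) : set path_space :=
  [set gam | (forall t, K (gam t)) /\
    forall s t, 0 <= s <= 1 -> 0 <= t <= 1 ->
      mdist (gam s) (gam t) = `|s - t| * mdist (gam 0) (gam 1)].

Lemma eval_continuous (t : R) : continuous (fun gam : path_space => gam t).
Proof. exact: proj_continuous. Qed.

Lemma closed_eq_continuous (U : topologicalType) (f h : U -> R) :
  continuous f -> continuous h -> closed [set u | f u = h u].
Proof.
move=> cf ch; rewrite (_ : [set u | _] = [set u | f u <= h u] `&` [set u | h u <= f u]).
  by apply: closedI; exact: closed_le_continuous.
apply/seteqP; split=> u /=; first by move=> ->.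
by move=> [fh hf]; apply/eqP; rewrite eq_le fh hf.
Qed.

Lemma geodesics_in_compact (K : set M) : compact K -> compact (geodesics_in K).
Proof.
move=> cK.
rewrite (_ : geodesics_in K = [set gam : path_space | forall t, K (gam t)] `&`
  \bigcap_(st in [set st : R * R | 0 <= st.1 <= 1 /\ 0 <= st.2 <= 1])
    [set gam : path_space | mdist (gam st.1) (gam st.2) =
      `|st.1 - st.2| * mdist (gam 0) (gam 1)]); last first.
  apply/seteqP; split=> [gam [gK gl]|gam [gK gl]]; split => //.
    by move=> [s t] [/= s01 t01]; exact: gl.
  by move=> s t s01 t01; exact: (gl (s, t)).
apply: compact_closedI; first by apply: (@tychonoff R (fun=> M) (fun=> K)).
apply: closed_bigI => st _; apply: closed_eq_continuous.
  by apply: continuous_mdist; exact: eval_continuous.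
apply: continuous_mul; first exact: continuous_const.
by apply: continuous_mdist; exact: eval_continuous.
Qed.

Definition clamp (t : R) : R := Num.max 0 (Num.min t 1).

Lemma clamp01 t : 0 <= clamp t <= 1.
Proof. by rewrite /clamp le_max lexx /= ge_max ler01 /= ge_min lexx orbT. Qed.

Lemma clampK t : 0 <= t <= 1 -> clamp t = t.
Proof. by move=> /andP[t0 t1]; rewrite /clamp (min_idPl t1) (max_idPr t0). Qed.

Lemma geodesic_lipschitz (p q : M) gam s t : minimizing_geodesic p q gam ->
  0 <= s <= 1 -> 0 <= t <= 1 -> mdist (gam s) (gam t) <= `|s - t| * mdist p q.
Proof. by move=> [_ _ h] s01 t01; rewrite h. Qed.

Lemma geodesic_range_compact (p q : M) gam : minimizing_geodesic p q gam ->
  compact (gam @` [set` `[0 : R, 1]]).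
Proof.
move=> pq; apply: continuous_compact; last exact: segment_compact.
apply/subspace_continuousP => t; rewrite /= in_itv /= => t01 A.
move=> /nbhs_ballP[e /= e0 eA].
have d0 : 0 < e / (mdist p q + 1).
  by rewrite divr_gt0// ltr_wpDl// mdist_ge0.
rewrite !nbhs_simpl /=; exists (e / (mdist p q + 1)) => // s ts s01; apply: eA.
rewrite ballEmdist /=.
move: s01; rewrite /= in_itv /= => s01.
apply: le_lt_trans (geodesic_lipschitz pq t01 s01) _.
move: ts; rewrite /ball_/= ltr_pdivlMr; last by rewrite ltr_wpDl// mdist_ge0.
by apply: le_lt_trans; rewrite ler_wpM2l// lerDl.
Qed.

Lemma clamped_geodesic (K : set M) (p q : M) gam : minimizing_geodesic p q gam ->
  gam @` [set` `[0 : R, 1]] `<=` K ->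
  [/\ geodesics_in K (gam \o clamp), (gam \o clamp) 0 = p, (gam \o clamp) 1 = q &
      forall t, 0 <= t <= 1 -> (gam \o clamp) t = gam t].
Proof.
move=> pq gK.
have gE t : 0 <= t <= 1 -> (gam \o clamp) t = gam t.
  by move=> t01; rewrite /= clampK.
have e0 : (gam \o clamp) 0 = p by rewrite gE ?lexx ?ler01//; case: pq.
have e1 : (gam \o clamp) 1 = q by rewrite gE ?lexx ?ler01//; case: pq.
split=> //; split.
  by move=> t; apply: gK; exists (clamp t) => //=; rewrite in_itv /=; exact: clamp01.
move=> s t s01 t01; rewrite e0 e1 !gE//.
by case: pq => _ _; apply.
Qed.

Lemma geodesics_in_minimizing K (gam : path_space) : geodesics_in K gam ->
  minimizing_geodesic (gam 0) (gam 1) gam.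
Proof. by move=> [_ h]; split. Qed.

(** Triples ((p, q), z) such that some minimizing geodesic from p to q inside K
has z in the ball around its midpoint. *)
Definition ball_witness (K : set M) : set ((M * M) * M) :=
  (fun u : path_space * M => ((u.1 0, u.1 1), u.2)) @`
  ((geodesics_in K `*` K) `&`
   [set u : path_space * M | mdist (u.1 (1 / 2)) u.2 <= mdist (u.1 0) (u.1 1) / 2]).

(** Endpoints of two minimizing geodesics inside K at distance at least e from
each other at time t. *)
Definition branching (K : set M) (t e : R) : set (M * M) :=
  (fun u : path_space * path_space => (u.1 0, u.1 1)) @`
  ((geodesics_in K `*` geodesics_in K) `&`
   [set u : path_space * path_space |
     [/\ mdist (u.1 0) (u.2 0) <= 0, mdist (u.1 1) (u.2 1) <= 0 &
         e <= mdist (u.1 t) (u.2 t)]]).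

Let ev1 (U : topologicalType) t : continuous (fun u : path_space * U => u.1 t).
Proof.
move=> u; apply: (@continuous_comp _ _ _ fst (fun gam : path_space => gam t)).
  exact: cvg_fst.
exact: eval_continuous.
Qed.

Let ev2 (U : topologicalType) t : continuous (fun u : U * path_space => u.2 t).
Proof.
move=> u; apply: (@continuous_comp _ _ _ snd (fun gam : path_space => gam t)).
  exact: cvg_snd.
exact: eval_continuous.
Qed.

(** It is a continuous image of a compact set of paths and points. *)
Lemma ball_witness_closed K : compact K -> closed (ball_witness K).
Proof.
move=> cK; apply: compact_closed.
  by apply: hausdorff_prod; [apply: hausdorff_prod|]; exact: metric_hausdorff.
apply: image_compact.
  apply: (@continuous_pair _ (M * M)%type M); last exact: continuous_snd.
  by apply: (@continuous_pair _ M M); exact: ev1.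
apply: compact_closedI.
  by apply: compact_setX => //; exact: geodesics_in_compact.
apply: closed_le_continuous.
  by apply: continuous_mdist; [exact: ev1|exact: continuous_snd].
apply: continuous_mul; last exact: continuous_const.
by apply: continuous_mdist; exact: ev1.
Qed.

Lemma branching_closed K t e : compact K -> closed (branching K t e).
Proof.
move=> cK; apply: compact_closed.
  by apply: hausdorff_prod; exact: metric_hausdorff.
apply: image_compact.
  by apply: (@continuous_pair _ M M); exact: ev1.
apply: compact_closedI.
  by apply: compact_setX; exact: geodesics_in_compact.
rewrite (_ : [set u | _] =
  [set u : path_space * path_space | mdist (u.1 0) (u.2 0) <= 0] `&`
  [set u | mdist (u.1 1) (u.2 1) <= 0] `&` [set u | e <= mdist (u.1 t) (u.2 t)]).
  have cd s : continuous (fun u : path_space * path_space => mdist (u.1 s) (u.2 s)).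
    by apply: continuous_mdist; [exact: ev1|exact: ev2].
  have cc (r : R) : continuous (fun u : path_space * path_space => r).
    exact: continuous_const.
  by apply: closedI; [apply: closedI|]; exact: closed_le_continuous.
by apply/seteqP; split=> u; [move=> [? ? ?]|move=> [[? ?] ?]].
Qed.

End geodesics.

Section ball_measurable.
Context {R : realType} {M : completeMetricType R}.
Hypothesis lcM : forall p : M, exists2 K, compact K & nbhs p K.
Hypothesis Msep : separable_space M.

Let dtri (x y z : M) : mdist x z <= mdist x y + mdist y z.
Proof. exact: metric_triangle. Qed.

Lemma closed_prod_measurable (A : set (borel M * borel M)) :
  @closed (M * M)%type A -> measurable A.
Proof.
move=> cA; rewrite -[A]setCK; apply: measurableC.
have bM := borel_basis Msep.
apply: (measurable_basis_open (measurable_basis_prod bM bM)).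
by apply: open_rect_open; rewrite openC.
Qed.

Lemma closed_prod3_measurable (A : set ((borel M * borel M) * borel M)) :
  @closed ((M * M) * M)%type A -> measurable A.
Proof.
move=> cA; rewrite -[A]setCK; apply: measurableC.
have bM := borel_basis Msep.
apply: (measurable_basis_open (measurable_basis_prod (measurable_basis_prod bM bM) bM)).
apply: (rect_openS (op1 := @open (M * M)%type)); first exact: open_rect_open.
by apply: (@open_rect_open (M * M)%type M); rewrite openC.
Qed.

(** Reduces non-uniqueness of geodesics to countably many times. *)
Lemma distinct_at_rational (p q : M) gam gam' (t : R) :
  minimizing_geodesic p q gam -> minimizing_geodesic p q gam' ->
  0 <= t <= 1 -> gam t <> gam' t ->
  exists r : rat, [/\ 0 <= (ratr r : R) <= 1 & 0 < mdist (gam (ratr r)) (gam' (ratr r))].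
Proof.
move=> pq pq' t01 ne.
have e0 : 0 < mdist (gam t) (gam' t) by rewrite mdist_gt0; apply/eqP.
have D0 : 0 <= mdist p q by exact: mdist_ge0.
set e := mdist (gam t) (gam' t) in e0; set D := mdist p q in D0.
(* the two arcs move with speed D, so they stay apart within e / (4 (D + 1)) *)
pose eta := e / (4 * (D + 1)).
have eta0 : 0 < eta by rewrite divr_gt0// mulr_gt0// ltr_wpDl.
have [r [r01 rt]] : exists r : rat, 0 <= (ratr r : R) <= 1 /\ `|ratr r - t| <= eta.
  have [tle|tlt] := leP t (1 / 2).
    have : t < Num.min (t + eta) 1 by rewrite lt_min ltrDl eta0 /=; lra.
    move=> /rat_in_itvoo[r]; rewrite in_itv /= lt_min => /and3P[r1 r2 r3].
    exists r; split; first by apply/andP; split; lra.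
    by rewrite ger0_norm; lra.
  have : Num.max (t - eta) 0 < t by rewrite gt_max gtrBl eta0 /=; lra.
  move=> /rat_in_itvoo[r]; rewrite in_itv /= gt_max => /andP[/andP[r1 r2] r3].
  exists r; split; first by apply/andP; split; lra.
  by rewrite ler0_norm; lra.
exists r; split => //.
have h1 : mdist (gam t) (gam (ratr r)) <= eta * D.
  apply: le_trans (geodesic_lipschitz pq t01 r01) _.
  by rewrite ler_wpM2r// distrC.
have h2 : mdist (gam' (ratr r)) (gam' t) <= eta * D.
  by apply: le_trans (geodesic_lipschitz pq' r01 t01) _; rewrite ler_wpM2r.
have hD : eta * D <= e / 4.
  rewrite /eta invfM mulrA -mulrA ler_piMr ?divr_ge0 ?(ltW e0)//.
  by rewrite mulrC ler_pdivrMr ?mul1r ?ltr_wpDl// lerDl.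
have h3 := dtri (gam t) (gam (ratr r)) (gam' t).
have h4 := dtri (gam (ratr r)) (gam' (ratr r)) (gam' t).
move: h1 h2 h3 h4; rewrite -/e.
move: (mdist _ _) (mdist (gam (ratr r)) (gam' t)) (mdist _ _) (mdist _ _) => a b c f.
lra.
Qed.

(** z is in B_pq when some geodesic inside some K n witnesses it and no two
geodesics from p to q branch, inside some K n, at a rational time, by at least
1/(k+1).  Each condition is closed for fixed n, time and k. *)
Lemma measurable_geodesic_ball : measurable
  [set u : (borel M * borel M) * borel M | geodesic_ball (u.1.1 : M) (u.1.2 : M) u.2].
Proof.
have [K [cK ndK exK]] := compact_exhaustion lcM Msep.
pose W := \bigcup_n ball_witness (K n).
pose Br := \bigcup_n \bigcup_(r in [set r : rat | 0 <= (ratr r : R) <= 1])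
  \bigcup_k branching (K n) (ratr r) k.+1%:R^-1.
have mW : @measurable _ ((borel M * borel M) * borel M)%type W.
  apply: bigcupT_measurable => n; apply: closed_prod3_measurable.
  exact: ball_witness_closed.
have mBr : @measurable _ (borel M * borel M)%type Br.
  apply: bigcupT_measurable => n.
  rewrite bigcup_mkcond; apply: bigcupT_measurable_rat => r.
  case: ifP => _; last exact: measurable0.
  apply: bigcupT_measurable => k; apply: closed_prod_measurable.
  exact: branching_closed.
rewrite (_ : [set u | _] = W `\` (Br `*` setT)).
  by apply: measurableD => //; apply: measurableX.
apply/seteqP; split=> [[[p q] z]|[[p q] z]] /=.
  move=> [gam [pq uniq] gz]; split.
    have [n gn] := exK _ (geodesic_range_compact pq).
    have cz : compact [set z : M] by exact: compact_set1.
    have [m zm] := exK _ cz.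
    have [gK g0 g1 gE] : [/\ geodesics_in (K (maxn n m)) (gam \o clamp),
        (gam \o clamp) 0 = p, (gam \o clamp) 1 = q &
        forall t, 0 <= t <= 1 -> (gam \o clamp) t = gam t].
      apply: clamped_geodesic pq _.
      by apply: subset_trans gn _; exact/ndK/leq_maxl.
    exists (maxn n m) => //; exists (gam \o clamp, z) => /=.
      split => /=; first by split => //=; apply: (ndK m); [exact: leq_maxr|exact: zm].
      have := gE (1 / 2); have := g0; have := g1; rewrite /= => -> -> -> //.
      by apply/andP; split; lra.
    by have := g0; have := g1; rewrite /= => -> ->.
  move=> [[n _ [r r01 [k _ [[ga gb] /= [[Ga Gb] [ab0 ab1 abr]] [pE qE]]]]] _].
  have ab c c' : mdist (c : M) c' <= 0 -> c = c'.
    by move=> h; apply: mdist_positivity; apply/eqP; rewrite eq_le h mdist_ge0.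
  have Ma := geodesics_in_minimizing Ga; have Mb := geodesics_in_minimizing Gb.
  move: Ma Mb; rewrite -(ab _ _ ab0) -(ab _ _ ab1) pE qE => Ma Mb.
  move: abr; rewrite (uniq _ Ma _ r01) (uniq _ Mb _ r01) mdistxx leNgt.
  by rewrite invr_gt0 ltr0n.
move=> [[n _ [[gam z'] /= [[Gg Kz] gz] [pE qE <-]]] nBr].
have Mg := geodesics_in_minimizing Gg.
exists gam; last by rewrite -pE -qE.
rewrite pE qE in Mg; split => // gam' Mg' t t01.
apply: contrapT => ne.
have [r [r01 dr]] := distinct_at_rational Mg' Mg t01 ne.
have [k kr] := inv_succ_lt dr.
apply: nBr; split => //.
have [m gm] := exK _ (geodesic_range_compact Mg').
have gn : gam @` [set` `[0 : R, 1]] `<=` K n.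
  by move=> _ [x _ <-]; case: Gg.
have [Ga a0 a1 aE] := clamped_geodesic Mg (subset_trans gn (ndK _ _ (leq_maxl n m))).
have [Gb b0 b1 bE] := clamped_geodesic Mg' (subset_trans gm (ndK _ _ (leq_maxr n m))).
exists (maxn n m) => //; exists r => //; exists k => //.
exists (gam' \o clamp, gam \o clamp) => /=; last by have := b0; have := b1; rewrite /= => -> ->.
split; first by split.
have := aE _ r01; have := bE _ r01; rewrite /= => -> ->.
have := b0; have := b1; have := a0; have := a1; rewrite /= => -> -> -> ->.
by rewrite !mdistxx; split => //; exact: ltW.
Qed.

End ball_measurable.

(** * Conditional expectation given part of an independent family *)

Section cond_exp_unique.
Context {d : measure_display} {T : measurableType d} {R : realType}.
Variable P : probability T R.

(** Both versions are densities of the same set function with respect to P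
restricted to the sub-sigma-algebra; the restriction is written as the image of
P under the identity. *)
Lemma cond_exp_unique (G : set (set T)) (Y E1 E2 : T -> R) :
  <<s G >> `<=` measurable ->
  is_cond_exp P <<s G >> Y E1 -> is_cond_exp P <<s G >> Y E2 ->
  \forall w \ae P, E1 w = E2 w.
Proof.
move=> Gm [mE1 iE1 hE1] [mE2 iE2 hE2].
pose S := g_sigma_algebraType G.
have mid : measurable_fun setT (id : T -> S).
  by move=> _ A mA; rewrite setTI; exact: Gm.
have mS (E : T -> R) : (forall B : set R, measurable B -> <<s G >> (E @^-1` B)) ->
    measurable_fun setT (EFin \o E : S -> \bar R).
  by move=> mE; apply/measurable_EFinP => _ B mB; rewrite setTI; exact: mE.
have int_id (E : T -> R) : measurable_fun setT (EFin \o E : S -> \bar R) ->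
    P.-integrable setT (EFin \o E) -> forall A : set S, measurable A ->
    (\int[pushforward P (id : T -> S)]_(x in A) (E x)%:E = \int[P]_(x in A) (E x)%:E)%E.
  move=> mE iE A mA; apply: (integral_pushforward mid mE) => //.
  by apply: integrableS iE => //; exact: Gm.
have : ae_eq (pushforward P (id : T -> S)) setT (EFin \o E1) (EFin \o E2).
  move=> mid'; apply: integral_ae_eq => //.
  - by apply: (integrable_pushforward mid) => //; exact: mS.
  - exact: mS.
  - move=> A _ mA; rewrite (int_id E1 (mS _ mE1) iE1 A mA).
    by rewrite (int_id E2 (mS _ mE2) iE2 A mA) hE1// hE2.
move=> /(_ mid)[N [mN PN NE]]; exists N; split => //; first exact: Gm.
by move=> w /= nE; apply: NE => /= h; apply: nE; have [] := h Logic.I.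
Qed.

Lemma variance_ae (E1 E2 : T -> R) : bounded_measurable E2 ->
  measurable_fun setT E1 -> (\forall w \ae P, E1 w = E2 w) ->
  fine 'V_P[E1]%E = \int[P]_w E2 w ^+ 2 - (\int[P]_w E2 w) ^+ 2.
Proof.
move=> bE2 mE1 E12.
have mE2 := bE2.1.
have e1 : fine 'E_P[E1]%E = \int[P]_w E2 w.
  rewrite unlock /Rintegral; congr fine; apply: ae_eq_integral => //.
  - exact/measurable_EFinP.
  - exact/measurable_EFinP.
  - by apply: filterS E12 => w /= -> _.
rewrite /variance unlock e1; set m := \int[P]_w E2 w.
transitivity (\int[P]_w (E2 w - m) ^+ 2).
  rewrite unlock /Rintegral; congr fine; apply: ae_eq_integral => //.
  - apply/measurable_EFinP; apply: measurable_funM;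
    by apply: measurable_funB => //; exact: measurable_cst.
  - by apply/measurable_EFinP; apply: (bmfX 2 (bmfB bE2 (bmf_cst m))).1.
  - by apply: filterS E12 => w e _; rewrite expr2 -e.
under eq_Rintegral do rewrite sqrrB.
have b2 := bmfX 2 bE2.
have bm : bounded_measurable (fun w => E2 w * m *+ 2).
  by under eq_fun do rewrite -mulrnAr mulrC; exact: bmfZ.
rewrite meanD; [|exact: bmfB|exact: bmf_cst].
rewrite meanB// mean_cst.
rewrite (_ : \int[P]_w (E2 w * m *+ 2) = m *+ 2 * m); last first.
  by under eq_Rintegral do rewrite -mulrnAr mulrC; rewrite meanZ.
by ring.
Qed.

End cond_exp_unique.

Section partial_cond_exp.
Context {d dE : measure_display} {T : measurableType d} {R : realType}
  {E : measurableType dE} {I : finType}.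
Variables (P : probability T R) (Y : I -> T -> E) (J : {set I}).
Hypothesis mY : forall i, measurable_fun setT (Y i).
Hypothesis indepY : mutually_independent P Y.
Variable phi : famType E I -> R.
Hypothesis bphi : bounded_measurable phi.

Let G : set (set T) := sigma_of [set` J] Y.

Let gens : set (set T) := [set B | exists i (A : set E),
  [/\ [set` J] i, measurable A & B = Y i @^-1` A] ].

Lemma sigma_of_measurable : G `<=` measurable.
Proof.
apply: smallest_sub; first exact: sigma_algebra_measurable.
by move=> _ [i [A [_ mA ->]]]; have := mY i measurableT mA; rewrite setTI.
Qed.

(* Freezing the coordinates outside J at a constant makes the sample measurable
   for the sigma-algebra of the coordinates in J. *)
Let ms0 : measurable_fun setT
  (fun w : g_sigma_algebraType gens => mix J (Y^~ w) (fun=> point) : famType E I).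
Proof.
apply: measurable_family => i; rewrite /mix; case iJ : (i \in J); last exact: measurable_cst.
by move=> _ A mA; rewrite setTI; apply: sub_sigma_algebra; exists i; exists A.
Qed.

(** The form of the events of sigma(Y_i, i in J) that can be used with
resampling: they are preimages of sets of families that ignore the coordinates
outside J. *)
Lemma sigma_of_factor (A : set T) : G A -> exists B : set (famType E I),
  [/\ measurable B, A = [set w | B (Y^~ w)] &
      forall y y', (forall i, i \in J -> y i = y' i) -> B y -> B y'].
Proof.
move: A; apply: smallest_sub; last first.
  move=> _ [i [A [iJ mA ->]]]; exists [set y | A (y i)]; split => //.
    by rewrite -[X in measurable X]setTI; exact: measurable_coord.
  by move=> y y' yy'; rewrite /= yy'.
split.
- by exists set0; split => //; exact: measurable0.
- move=> _ [B [mB -> BJ]]; exists (~` B); split; first exact: measurableC.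
    by rewrite setTD.
  by move=> y y' yy' nB By'; apply: nB; apply: BJ By' => i iJ; rewrite yy'.
- move=> F /choice[B HB]; exists (\bigcup_n B n); split.
  + by apply: bigcupT_measurable => n; have [] := HB n.
  + apply/seteqP; split=> [w [n _]|w [n _ Bn]].
      by have [_ -> _] := HB n => Bn; exists n.
    by exists n => //; have [_ -> _] := HB n.
  + move=> y y' yy' [n _ Bn]; exists n => //.
    by have [_ _ h] := HB n; exact: h Bn.
Qed.

(** The coordinates outside J are integrated out; composed with the sample this
is the conditional expectation given the coordinates in J. *)
Definition partial_mean (y : famType E I) : R := \int[P]_w phi (mix J y (Y^~ w)).

Let mixJ (y y' z : famType E I) : (forall i, i \in J -> y i = y' i) ->
  mix J y z = mix J y' z.
Proof. by move=> yy'; apply/funext => i; rewrite /mix; case: ifPn => // /yy'. Qed.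

Lemma partial_mean_mix y z : partial_mean (mix J y z) = partial_mean y.
Proof.
apply: eq_Rintegral => w _; congr phi; apply: mixJ => i iJ.
by rewrite /mix iJ.
Qed.

Let bphi2 : bounded_measurable
  (fun z : famType E I * T => phi (mix J z.1 (Y^~ z.2))).
Proof.
apply: (bmf_comp (phi := fun z : famType E I * T => mix J z.1 (Y^~ z.2))) => //.
apply: measurable_mix; first exact: measurable_fst.
exact: (measurableT_comp (measurable_sample mY) measurable_snd).
Qed.

Lemma bmf_partial_mean : bounded_measurable partial_mean.
Proof. exact: (bmf_mean1 P bphi2). Qed.

(** Resampling outside J changes neither the mean nor psi, and inside the inner
integral psi is a constant factor. *)
Lemma mean_times_partial (psi : famType E I -> R) : bounded_measurable psi ->
  (forall y z, psi (mix J y z) = psi y) ->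
  \int[P]_w (psi (Y^~ w) * phi (Y^~ w)) =
  \int[P]_w (psi (Y^~ w) * partial_mean (Y^~ w)).
Proof.
move=> bpsi psiJ.
rewrite (mean_resample mY indepY J (bmfM bpsi bphi)).
apply: eq_Rintegral => w _.
under eq_Rintegral do rewrite psiJ.
rewrite meanZ//; exact: (bmf_pair1 bphi2).
Qed.

Lemma partial_mean_cond_exp :
  is_cond_exp P G (fun w => phi (Y^~ w)) (fun w => partial_mean (Y^~ w)).
Proof.
have ms := measurable_sample mY.
split.
- move=> B mB.
  have h := measurableT_comp bmf_partial_mean.1 ms0 measurableT mB.
  have -> : (fun w => partial_mean (Y^~ w)) =
      partial_mean \o (fun w => mix J (Y^~ w) (fun=> point)).
    by apply/funext => w; rewrite /= partial_mean_mix.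
  by rewrite -[X in G X]setTI.
- exact: (bmf_integrable P (bmf_comp ms bmf_partial_mean)).
- move=> A /sigma_of_factor[B [mB -> BJ]].
  have b1 : bounded_measurable (\1_B : famType E I -> R) by exact: bmf_indic.
  have b1J y z : (\1_B (mix J y z) : R) = \1_B y.
    rewrite !indicE; congr (_%:R); congr nat_of_bool; apply/idP/idP; rewrite !inE.
      by apply: BJ => i iJ; rewrite /mix iJ.
    by apply: BJ => i iJ; rewrite /mix iJ.
  have conv (psi : famType E I -> R) : bounded_measurable psi ->
      (\int[P]_(w in [set w | B (Y^~ w)]) (psi (Y^~ w))%:E)%E =
      (\int[P]_w (\1_B (Y^~ w) * psi (Y^~ w)))%:E.
    move=> bpsi; rewrite EFin_mean; last exact: (bmf_comp ms (bmfM b1 bpsi)).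
    rewrite integral_mkcond; apply: eq_integral => w _.
    rewrite /patch indicE; have -> : (w \in [set w | B (Y^~ w)]) = ((Y^~ w) \in B).
      by apply/idP/idP; rewrite !inE.
    by case: ifP => _ /=; rewrite ?mul1r ?mul0r.
  by rewrite !conv//; [congr EFin; rewrite mean_times_partial|exact: bmf_partial_mean].
Qed.

(** The pick-freeze identity: the second moment of the conditional expectation
is the mean of phi(Y) times its conditional expectation, that is, of the product
of phi at Y and at Y resampled outside J. *)
Lemma variance_cond_exp :
  fine 'V_P[cond_exp P G (fun w => phi (Y^~ w))]%E =
  \int[P]_w \int[P]_w' (phi (Y^~ w) * phi (mix J (Y^~ w) (Y^~ w')))
  - (\int[P]_w phi (Y^~ w)) ^+ 2.
Proof.
have ms := measurable_sample mY.
have cE : is_cond_exp P G (fun w => phi (Y^~ w))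
    (cond_exp P G (fun w => phi (Y^~ w))).
  by apply: (@xgetPex _ (cst 0) [set E | is_cond_exp P G _ E]);
    exists (fun w => partial_mean (Y^~ w)); exact: partial_mean_cond_exp.
have mc : measurable_fun setT (cond_exp P G (fun w => phi (Y^~ w))).
  by move=> _ B mB; rewrite setTI; apply: sigma_of_measurable; case: cE => + _ _; apply.
rewrite (variance_ae (bmf_comp ms bmf_partial_mean) mc
  (cond_exp_unique sigma_of_measurable cE partial_mean_cond_exp)).
have -> : \int[P]_w partial_mean (Y^~ w) = \int[P]_w phi (Y^~ w).
  by rewrite (mean_resample mY indepY J bphi).
congr (_ - _).
under eq_Rintegral do rewrite expr2.
rewrite -mean_times_partial; first last.
- exact: partial_mean_mix.
- exact: bmf_partial_mean.
apply: eq_Rintegral => w _; rewrite meanZ; last exact: (bmf_pair1 bphi2).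
by rewrite mulrC.
Qed.

End partial_cond_exp.

(** * The statistic: bounded differences *)

Lemma dist_sum1 (R : realDomainType) (I : finType) (i0 : I) (u v : I -> R) (b : R) :
  (forall i, i != i0 -> u i = v i) -> `|u i0 - v i0| <= b ->
  `|\sum_i u i - \sum_i v i| <= b.
Proof.
move=> uv b0; rewrite -sumrB (bigD1 i0)//= big1 ?addr0// => i /uv ->.
by rewrite subrr.
Qed.

Lemma mean_range (R : realFieldType) (N : nat) (u : 'I_N -> R) : (0 < N)%N ->
  (forall j, 0 <= u j <= 1) -> 0 <= N%:R^-1 * \sum_j u j <= 1.
Proof.
move=> N0 u01; apply/andP; split.
  by rewrite mulr_ge0 ?invr_ge0 ?sumr_ge0// => j _; case/andP: (u01 j).
rewrite mulrC ler_pdivrMr ?ltr0n// mul1r.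
apply: (@le_trans _ _ (\sum_(j < N) 1)); last by rewrite sumr_const card_ord.
by apply: ler_sum => j _; case/andP: (u01 j).
Qed.

Lemma sum_ordered_pairs (V : nmodType) (N : nat) (F : 'I_N -> 'I_N -> V) :
  \sum_(tau : 'I_N * 'I_N | (tau.1 < tau.2)%N) F tau.1 tau.2 =
  \sum_(j < N) \sum_(i < N | (i < j)%N) F i j.
Proof.
rewrite -(pair_big_dep xpredT (fun i j : 'I_N => (i < j)%N) F)/=.
by rewrite (exchange_big_dep xpredT).
Qed.

Lemma card_ordered_pairs (R : pzSemiRingType) (N : nat) :
  \sum_(tau : 'I_N * 'I_N | (tau.1 < tau.2)%N) 1 = 'C(N, 2)%:R :> R.
Proof.
rewrite (sum_ordered_pairs (fun _ _ => 1 : R)) -bin2_sum big_mkord natr_sum.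
apply: eq_bigr => j _.
by rewrite -(big_ord_widen N (fun=> 1 : R)) ?sumr_const ?card_ord// ltnW.
Qed.

Lemma bin2_natr (R : realFieldType) N : (0 < N)%N ->
  'C(N, 2)%:R = N%:R * (N%:R - 1) / 2 :> R.
Proof.
case: N => // n _; have : ('C(n.+1, 2) * 2 = n.+1 * n)%N.
  by have := bin_ffact n.+1 2; rewrite (_ : 2`! = 2)%N// ffactnS ffactn1.
move=> /(congr1 (fun k => k%:R : R)); rewrite !natrM.
have -> : n.+1%:R - 1 = n%:R :> R by rewrite -natr1 addrK.
move=> <-.
by rewrite mulfK// pnatr_eq0.
Qed.

(** An index k is paired once with each of the N - 1 other indices. *)
Lemma sum_pairs_through (R : realFieldType) N (k : 'I_N) :
  \sum_(tau : 'I_N * 'I_N | (tau.1 < tau.2)%N)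
    ((tau.1 == k) || (tau.2 == k))%:R <= N%:R - 1 :> R.
Proof.
apply: (@le_trans _ _ (\sum_(tau : 'I_N * 'I_N | (tau.1 < tau.2)%N)
    ((tau.1 == k)%:R + (tau.2 == k)%:R))).
  apply: ler_sum => tau _; case: (tau.1 == k); case: (tau.2 == k);
  by rewrite /= ?addr0 ?add0r ?lerDl ?ler01.
rewrite (sum_ordered_pairs (fun i j => (i == k)%:R + (j == k)%:R)).
have delta (p : pred 'I_N) : \sum_(i < N | p i) (i == k)%:R = (p k)%:R :> R.
  rewrite big_mkcond (bigD1 k)//= eqxx big1 ?addr0; first by case: (p k).
  by move=> i /negbTE ->; case: ifP.
have lt_k : \sum_(j < N) \sum_(i < N | (i < j)%N) (j == k)%:R =
    \sum_(i < N) (i < k)%:R :> R.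
  rewrite (bigD1 k)//= [X in _ + X]big1 ?addr0; last first.
    by move=> j /negbTE ->; rewrite big1.
  by rewrite eqxx big_mkcond; apply: eq_bigr => i _; case: ifP.
under eq_bigr do rewrite big_split /= (delta (fun i => (i < _)%N)).
rewrite big_split /= lt_k -big_split /=.
apply: (@le_trans _ _ (\sum_(j < N) (1 - (j == k)%:R))).
  apply: ler_sum => j _; case: (ltngtP k j) => [kj|jk|kj].
  - by rewrite addr0 -val_eqE /= gtn_eqF ?subr0.
  - by rewrite add0r -val_eqE /= ltn_eqF ?subr0.
  - by rewrite addr0 -val_eqE /= kj eqxx subrr.
rewrite sumrB sumr_const card_ord (delta xpredT)//.
Qed.

Section statistic.
Context {S : Type} {R : realType}.

(** The summand of the estimator attached to one ball, whose indicator is [a]. *)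
Definition pf_term N (Z Znu : 'I_N -> S) (a : S -> R) : R :=
  N%:R^-1 * (\sum_(j < N) a (Z j) * a (Znu j)) -
     ((2 * N%:R)^-1 * \sum_(j < N) (a (Z j) + a (Znu j))) ^+ 2.

Lemma pf_termE N (Z Znu : 'I_N -> S) (a : S -> R) :
  pf_term Z Znu a = N%:R^-1 * (\sum_(j < N) a (Z j) * a (Znu j)) -
     (N%:R^-1 * \sum_(j < N) ((a (Z j) + a (Znu j)) / 2)) ^+ 2.
Proof.
rewrite /pf_term -mulr_suml invfM mulrC [2^-1 * _]mulrC -mulrA.
by congr (_ - (_ * _) ^+ 2); rewrite mulrC.
Qed.

Section range.
Variables (N : nat) (a : S -> R).
Hypothesis N0 : (0 < N)%N.
Hypothesis a01 : forall z, 0 <= a z <= 1.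

Let N0R : 0 < N%:R :> R. Proof. by rewrite ltr0n. Qed.

Let prod01 z z' : 0 <= a z * a z' <= 1.
Proof.
have /andP[z0 z1] := a01 z; have /andP[z0' z1'] := a01 z'.
by rewrite mulr_ge0// mulr_ile1.
Qed.

Let half01 z z' : 0 <= (a z + a z') / 2 <= 1.
Proof. by have := a01 z; have := a01 z'; lra. Qed.

Lemma pf_term_norm (Z Znu : 'I_N -> S) : `|pf_term Z Znu a| <= 1.
Proof.
rewrite pf_termE.
have /andP[A0 A1] := mean_range N0 (fun j => prod01 (Z j) (Znu j)).
have /andP[B0 B1] := mean_range N0 (fun j => half01 (Z j) (Znu j)).
have B2 := exprn_ile1 2 B0 B1; have B3 := sqr_ge0 (N%:R^-1 * (\sum_j (a (Z j) + a (Znu j)) / 2)).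
by rewrite ler_norml; apply/andP; split; lra.
Qed.

(** The average of the products and the average that is squared, both in [0, 1],
move by at most 1/N, hence the difference by at most 3/N. *)
Lemma pf_term_close (Z Znu Z' Znu' : 'I_N -> S) (j0 : 'I_N) :
  (forall j, j != j0 -> Z j = Z' j /\ Znu j = Znu' j) ->
  `|pf_term Z Znu a - pf_term Z' Znu' a| <= 4 / N%:R.
Proof.
move=> ZZ'; rewrite !pf_termE.
set A := N%:R^-1 * _; set B := N%:R^-1 * _; set A' := N%:R^-1 * _; set B' := N%:R^-1 * _.
have hA : `|A - A'| <= N%:R^-1.
  rewrite -mulrBr normrM gtr0_norm ?invr_gt0// ler_piMr ?invr_ge0 ?(ltW N0R)//.
  apply: (dist_sum1 (i0 := j0)) => [j /ZZ'[-> ->]//|].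
  have := prod01 (Z j0) (Znu j0); have := prod01 (Z' j0) (Znu' j0).
  by rewrite ler_norml => /andP[? ?] /andP[? ?]; apply/andP; split; lra.
have hB : `|B - B'| <= N%:R^-1.
  rewrite -mulrBr normrM gtr0_norm ?invr_gt0// ler_piMr ?invr_ge0 ?(ltW N0R)//.
  apply: (dist_sum1 (i0 := j0)) => [j /ZZ'[-> ->]//|].
  have := half01 (Z j0) (Znu j0); have := half01 (Z' j0) (Znu' j0).
  by rewrite ler_norml => /andP[? ?] /andP[? ?]; apply/andP; split; lra.
have /andP[B0 B1] := mean_range N0 (fun j => half01 (Z j) (Znu j)).
have /andP[B0' B1'] := mean_range N0 (fun j => half01 (Z' j) (Znu' j)).
have hB2 : `|B ^+ 2 - B' ^+ 2| <= N%:R^-1 * 2.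
  rewrite subr_sqr normrM ler_pM// ger0_norm ?addr_ge0//.
  by rewrite -/B -/B' in B1 B1' *; lra.
have -> : A - B ^+ 2 - (A' - B' ^+ 2) = (A - A') - (B ^+ 2 - B' ^+ 2) by ring.
apply: le_trans (ler_normB _ _) _.
have : 0 < N%:R^-1 :> R by rewrite invr_gt0.
lra.
Qed.

End range.

Variable h : S -> S -> S -> R.
Hypothesis h01 : forall a b c, 0 <= h a b c <= 1.

Definition pf_stat N (Z Znu W : 'I_N -> S) : R :=
  'C(N, 2)%:R^-1 * \sum_(tau : 'I_N * 'I_N | (tau.1 < tau.2)%N)
    pf_term Z Znu (h (W tau.1) (W tau.2)).

Variable N : nat.
Hypothesis N1 : (1 < N)%N.

Let N0 : (0 < N)%N. Proof. exact: ltnW. Qed.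

Let C0 : 0 < 'C(N, 2)%:R :> R.
Proof. by rewrite ltr0n bin_gt0. Qed.

Lemma pairs_average_norm (u : 'I_N * 'I_N -> R) (b : R) :
  (forall tau : 'I_N * 'I_N, (tau.1 < tau.2)%N -> `|u tau| <= b) ->
  `|'C(N, 2)%:R^-1 * \sum_(tau : 'I_N * 'I_N | (tau.1 < tau.2)%N) u tau| <= b.
Proof.
move=> ub; rewrite normrM gtr0_norm ?invr_gt0// mulrC ler_pdivrMr//.
apply: le_trans (ler_norm_sum _ _ _) _.
rewrite -card_ordered_pairs mulr_sumr; apply: ler_sum => tau ?.
by rewrite mulr1; exact: ub.
Qed.

Lemma pf_stat_norm (Z Znu W : 'I_N -> S) : `|pf_stat Z Znu W| <= 1.
Proof. by apply: pairs_average_norm => tau _; exact: pf_term_norm. Qed.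

Lemma pf_stat_close_pairs (Z Znu Z' Znu' W : 'I_N -> S) (j0 : 'I_N) :
  (forall j, j != j0 -> Z j = Z' j /\ Znu j = Znu' j) ->
  `|pf_stat Z Znu W - pf_stat Z' Znu' W| <= 4 / N%:R.
Proof.
move=> ZZ'; rewrite -mulrBr -sumrB; apply: pairs_average_norm => tau _.
exact: pf_term_close ZZ'.
Qed.

(** Each of the at most N - 1 terms involving k moves by at most 2, and
2 (N - 1) divided by N (N - 1) / 2 is 4 / N. *)
Lemma pf_stat_close_balls (Z Znu W W' : 'I_N -> S) (k : 'I_N) :
  (forall i, i != k -> W i = W' i) ->
  `|pf_stat Z Znu W - pf_stat Z Znu W'| <= 4 / N%:R.
Proof.
move=> WW'; rewrite -mulrBr -sumrB normrM gtr0_norm ?invr_gt0//.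
rewrite mulrC ler_pdivrMr//; apply: le_trans (ler_norm_sum _ _ _) _.
apply: (@le_trans _ _ (\sum_(tau : 'I_N * 'I_N | (tau.1 < tau.2)%N)
    2 * ((tau.1 == k) || (tau.2 == k))%:R)).
  apply: ler_sum => -[i j] _ /=.
  have [->|ik] := eqVneq i k; last have [->|jk] := eqVneq j k.
  - rewrite /= mulr1; apply: le_trans (ler_normB _ _) _.
    by rewrite -[leRHS]/(1 + 1) lerD ?pf_term_norm.
  - rewrite /= mulr1; apply: le_trans (ler_normB _ _) _.
    by rewrite -[leRHS]/(1 + 1) lerD ?pf_term_norm.
  - by rewrite (WW' _ ik) (WW' _ jk) subrr normr0 mulr0.
rewrite -mulr_sumr bin2_natr//.
apply: le_trans (ler_wpM2l _ (sum_pairs_through R k)) _ => //.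
rewrite le_eqVlt; apply/orP; left; apply/eqP.
have : N%:R != 0 :> R by rewrite pnatr_eq0 -lt0n.
by move=> ?; field.
Qed.

End statistic.

(** * The statistic: mean and concentration *)

Section two_indices.
Context {d dE : measure_display} {T : measurableType d} {R : realType}
  {E : measurableType dE} {I : finType}.
Variables (P : probability T R) (Y : I -> T -> E).
Hypothesis mY : forall i, measurable_fun setT (Y i).
Hypothesis indepY : mutually_independent P Y.

Lemma mean_two_indices (i j : I) (psi : E * E -> R) : i != j ->
  bounded_measurable psi ->
  \int[P]_w psi (Y i w, Y j w) = \int[P]_w \int[P]_w' psi (Y i w, Y j w').
Proof.
move=> ij bpsi.
have bp : bounded_measurable (fun y : famType E I => psi (y i, y j)).
  apply: (bmf_comp (phi := fun y : famType E I => (y i, y j))) => //.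
  by apply: measurable_fun_pair; exact: measurable_coord.
rewrite (mean_resample mY indepY [set i] bp).
apply: eq_Rintegral => w _; apply: eq_Rintegral => w' _.
by rewrite /mix !inE eqxx eq_sym (negbTE ij).
Qed.

End two_indices.

Section sample.
Context {dS : measure_display} {S : measurableType dS} {R : realType}.
Variable h : S -> S -> S -> R.
Hypothesis bh : bounded_measurable (fun u : (S * S) * S => h u.1.1 u.1.2 u.2).
Hypothesis h01 : forall a b c, 0 <= h a b c <= 1.
Context {d : measure_display} {T : measurableType d} (P : probability T R).
Context {dQ : measure_display} {O : measurableType dQ} (Q : probability O R).
Variables (out : T -> S) (pair_out : O -> S * S).
Hypothesis mout : measurable_fun setT out.
Hypothesis mpair : measurable_fun setT pair_out.
Hypothesis law_fst : forall a : S -> R, bounded_measurable a ->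
  \int[Q]_w a (pair_out w).1 = \int[P]_w a (out w).
Hypothesis law_snd : forall a : S -> R, bounded_measurable a ->
  \int[Q]_w a (pair_out w).2 = \int[P]_w a (out w).
Variable N : nat.
Hypothesis N1 : (1 < N)%N.
Context {d' : measure_display} {T' : measurableType d'} (P' : probability T' R).
Local Notation idx := ('I_N + 'I_N)%type.
Variable Y : idx -> T' -> S * S.
Hypothesis mY : forall i, measurable_fun setT (Y i).
Hypothesis indepY : mutually_independent P' Y.
Hypothesis law_pair : forall j A, measurable A ->
  P' (Y (inl j) @^-1` A) = Q (pair_out @^-1` A).
Hypothesis law_ball : forall k A, measurable A ->
  P' ((fun w => (Y (inr k) w).1) @^-1` A) = P (out @^-1` A).

Let N0 : (0 < N)%N. Proof. exact: ltnW. Qed.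
Let N0R : 0 < N%:R :> R. Proof. by rewrite ltr0n. Qed.

Lemma bmf_ball (z1 z2 : S) : bounded_measurable (h z1 z2).
Proof. exact: (bmf_pair1 bh (z1, z2)). Qed.

(** The right-hand side of the pick-freeze identity for the ball of z.1 and
z.2. *)
Definition sobol_variance (z : S * S) : R :=
  \int[Q]_w (h z.1 z.2 (pair_out w).1 * h z.1 z.2 (pair_out w).2)
  - (\int[P]_w h z.1 z.2 (out w)) ^+ 2.

Definition sobol_mean : R := \int[P]_w \int[P]_w' sobol_variance (out w, out w').

Lemma bmf_sobol_variance : bounded_measurable sobol_variance.
Proof.
have b3 d3 (T3 : measurableType d3) (phi : T3 -> S * S) (rho : T3 -> S) :
    measurable_fun setT phi -> measurable_fun setT rho ->
    bounded_measurable (fun x => h (phi x).1 (phi x).2 (rho x)).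
  move=> mphi mrho; apply: (bmf_comp (phi := fun x => (phi x, rho x)) _ bh).
  exact: measurable_fun_pair.
apply: bmfB.
  apply: (bmf_mean1 Q (g := fun u : (S * S) * O =>
    h u.1.1 u.1.2 (pair_out u.2).1 * h u.1.1 u.1.2 (pair_out u.2).2)).
  apply: bmfM; apply: b3 => //.
    exact: (measurableT_comp measurable_fst (measurableT_comp mpair measurable_snd)).
  exact: (measurableT_comp measurable_snd (measurableT_comp mpair measurable_snd)).
apply: bmfX.
apply: (bmf_mean1 P (g := fun u : (S * S) * T => h u.1.1 u.1.2 (out u.2))).
by apply: b3 => //; exact: (measurableT_comp mout measurable_snd).
Qed.

Lemma mean_pair j (g : S * S -> R) : bounded_measurable g ->
  \int[P']_w g (Y (inl j) w) = \int[Q]_w g (pair_out w).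
Proof. by move=> bg; apply: mean_same_law => //; exact: law_pair. Qed.

Lemma mean_ball k (g : S -> R) : bounded_measurable g ->
  \int[P']_w g (Y (inr k) w).1 = \int[P]_w g (out w).
Proof.
move=> bg; apply: mean_same_law => //; last exact: law_ball.
exact: (measurableT_comp measurable_fst (mY _)).
Qed.

Section fixed_ball.
Variable a : S -> R.
Hypothesis ba : bounded_measurable a.
Hypothesis a01 : forall z, 0 <= a z <= 1.

Let p : R := \int[P]_w a (out w).

Let b (e : S * S) : R := (a e.1 + a e.2) / 2.

Let b1 : bounded_measurable (fun e : S * S => a e.1).
Proof. exact: bmf_comp measurable_fst ba. Qed.

Let b2 : bounded_measurable (fun e : S * S => a e.2).
Proof. exact: bmf_comp measurable_snd ba. Qed.

Let bb : bounded_measurable b.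
Proof. by apply: bmfM; [exact: bmfD|exact: bmf_cst]. Qed.

Let b01 e : 0 <= b e <= 1.
Proof. by rewrite /b; have := a01 e.1; have := a01 e.2; lra. Qed.

Let bY j : bounded_measurable (fun w => b (Y (inl j) w)).
Proof. exact: bmf_comp (mY _) bb. Qed.

Let mean_b j : \int[P']_w b (Y (inl j) w) = p.
Proof.
rewrite mean_pair// /b.
have c1 := bmf_comp mpair b1; have c2 := bmf_comp mpair b2.
under eq_Rintegral do rewrite mulrC; rewrite meanZ; last exact: bmfD.
rewrite meanD// law_fst// law_snd// -/p; lra.
Qed.

Let p01 : 0 <= p <= 1.
Proof.
have ca := bmf_comp mout ba.
apply/andP; split; [apply: mean_ge_cst|apply: mean_le_cst] => // w;
by case/andP: (a01 (out w)).
Qed.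

(** Expanding the square, the N (N - 1) off-diagonal terms have mean p^2 by
independence and each of the N diagonal ones is off by at most 1. *)
Lemma mean_square_average :
  `|\int[P']_w (N%:R^-1 * \sum_(j < N) b (Y (inl j) w)) ^+ 2 - p ^+ 2| <= N%:R^-1.
Proof.
have e2 w : (N%:R^-1 * \sum_(j < N) b (Y (inl j) w)) ^+ 2 =
    N%:R^-2 * \sum_(i < N) \sum_(j < N) b (Y (inl i) w) * b (Y (inl j) w).
  by rewrite exprMn exprVn; congr (_ * _); rewrite expr2 big_distrlr.
under eq_Rintegral do rewrite e2.
have bij i j : bounded_measurable (fun w => b (Y (inl i) w) * b (Y (inl j) w)).
  exact: bmfM.
rewrite meanZ; last by apply: bmf_sum => i; exact: bmf_sum.
rewrite mean_sum => [|i]; last exact: bmf_sum.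
have -> : p ^+ 2 = N%:R^-2 * \sum_(i < N) \sum_(j < N) p ^+ 2.
  rewrite !sumr_const card_ord -mulr_natl -[p ^+ 2 *+ N]mulr_natl.
  by field; rewrite pnatr_eq0 -lt0n.
rewrite -mulrBr normrM gtr0_norm ?invr_gt0 ?exprn_gt0//.
rewrite (_ : N%:R^-1 = N%:R^-2 * N%:R); last by field; rewrite pnatr_eq0 -lt0n.
rewrite ler_pM2l ?invr_gt0 ?exprn_gt0//.
rewrite -sumrB; apply: le_trans (ler_norm_sum _ _ _) _.
have -> : N%:R = \sum_(i < N) 1 :> R by rewrite sumr_const card_ord.
apply: ler_sum => i _.
rewrite mean_sum// -sumrB (bigD1 i)//= big1 ?addr0 => [|j ji].
  have h1 : 0 <= \int[P']_w (b (Y (inl i) w) * b (Y (inl i) w)) <= 1.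
    apply/andP; split; [apply: mean_ge_cst|apply: mean_le_cst] => // w.
      by have /andP[x0 x1] := b01 (Y (inl i) w); rewrite mulr_ge0.
    by have /andP[x0 x1] := b01 (Y (inl i) w); rewrite mulr_ile1.
  have p2 : 0 <= p ^+ 2 <= 1.
    by rewrite sqr_ge0 exprn_ile1//; case/andP: p01.
  by rewrite ler_norml; apply/andP; split; lra.
apply/eqP; rewrite subr_eq0; apply/eqP.
rewrite (mean_two_indices mY indepY (i := inl i) (j := inl j)
  (psi := fun ee => b ee.1 * b ee.2)); first last.
- by apply: bmfM; [exact: bmf_comp measurable_fst bb|exact: bmf_comp measurable_snd bb].
- by apply: contra ji => /eqP[->].
rewrite /=; under eq_Rintegral do rewrite meanZ// mean_b mulrC.
by rewrite meanZ// mean_b expr2.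
Qed.

Lemma mean_pf_term_fixed :
  `|\int[P']_w pf_term (fun j => (Y (inl j) w).1) (fun j => (Y (inl j) w).2) a
    - (\int[Q]_w (a (pair_out w).1 * a (pair_out w).2) - p ^+ 2)| <= N%:R^-1.
Proof.
under eq_Rintegral do rewrite pf_termE.
have bp : bounded_measurable (fun e : S * S => a e.1 * a e.2) by exact: bmfM.
have bpY j : bounded_measurable (fun w => a (Y (inl j) w).1 * a (Y (inl j) w).2).
  exact: bmf_comp (mY _) bp.
rewrite meanB; [|by apply/bmfZ/bmf_sum|by apply/bmfX/bmfZ/bmf_sum].
rewrite meanZ ?mean_sum//; last exact: bmf_sum.
under eq_bigr do rewrite (mean_pair _ bp).
rewrite sumr_const card_ord -[X in N%:R^-1 * X]mulr_natl mulKf ?pnatr_eq0 -?lt0n//.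
set C := \int[Q]_w _; set B2 := \int[P']_x _.
have -> : C - B2 - (C - p ^+ 2) = - (B2 - p ^+ 2) by ring.
by rewrite normrN; exact: mean_square_average.
Qed.

End fixed_ball.

(** The sample is one family: the indices [inl j] carry the pairs, and the
indices [inr k] the points W_k, doubled so that all blocks have the same
type. *)
Definition term_of (k1 k2 : 'I_N) (y : famType (S * S)%type idx) : R :=
  pf_term (fun j => (y (inl j)).1) (fun j => (y (inl j)).2)
    (h (y (inr k1)).1 (y (inr k2)).1).

Definition stat_of (y : famType (S * S)%type idx) : R :=
  pf_stat h (fun j => (y (inl j)).1) (fun j => (y (inl j)).2)
    (fun k => (y (inr k)).1).

Lemma bmf_term k1 k2 : bounded_measurable (term_of k1 k2).
Proof.
have m1 i : measurable_fun setT (fun y : famType (S * S)%type idx => (y i).1).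
  exact: (measurableT_comp measurable_fst (measurable_coord i)).
have m2 i : measurable_fun setT (fun y : famType (S * S)%type idx => (y i).2).
  exact: (measurableT_comp measurable_snd (measurable_coord i)).
have bk (rho : famType (S * S)%type idx -> S) : measurable_fun setT rho ->
    bounded_measurable (fun y : famType (S * S)%type idx =>
      h (y (inr k1)).1 (y (inr k2)).1 (rho y)).
  move=> mrho; apply: (bmf_comp (phi := fun y : famType (S * S)%type idx =>
    (((y (inr k1)).1, (y (inr k2)).1), rho y)) _ bh).
  by apply: measurable_fun_pair => //; exact: measurable_fun_pair.
apply: bmfB.
  by apply/bmfZ/bmf_sum => j; apply: bmfM; exact: bk.
by apply/bmfX/bmfZ/bmf_sum => j; apply: bmfD; exact: bk.
Qed.

Lemma bmf_stat : bounded_measurable stat_of.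
Proof.
exact: (bmfZ _ (bmf_sum (F := fun tau => term_of tau.1 tau.2) _ _
  (fun tau => bmf_term tau.1 tau.2))).
Qed.

Lemma variation_stat : variation_bound stat_of (fun=> 4 / N%:R).
Proof.
move=> [j0|k0] y y' yy'; rewrite /stat_of.
  have -> : (fun k => (y (inr k)).1) = (fun k => (y' (inr k)).1).
    by apply/funext => k; rewrite yy'.
  apply: (@pf_stat_close_pairs _ _ _ h01 _ N1 _ _ _ _ _ j0) => j jj.
  by rewrite yy'//; apply: contra jj => /eqP[->].
have -> : (fun j => (y (inl j)).1) = (fun j => (y' (inl j)).1).
  by apply/funext => j; rewrite yy'.
have -> : (fun j => (y (inl j)).2) = (fun j => (y' (inl j)).2).
  by apply/funext => j; rewrite yy'.
apply: (@pf_stat_close_balls _ _ _ h01 _ N1 _ _ _ _ k0) => k kk.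
by rewrite yy'//; apply: contra kk => /eqP[->].
Qed.

(** The balls are independent of the pairs, so the bound for a fixed ball can be
integrated over the ball; its two points are themselves independent. *)
Lemma mean_term (k1 k2 : 'I_N) : k1 != k2 ->
  `|\int[P']_w term_of k1 k2 (Y^~ w) - sobol_mean| <= N%:R^-1.
Proof.
move=> k12.
have bV := bmf_sobol_variance.
pose V2 (ee : (S * S) * (S * S)) := sobol_variance (ee.1.1, ee.2.1).
have bV2 : bounded_measurable V2.
  apply: (bmf_comp (phi := fun ee : (S * S) * (S * S) => (ee.1.1, ee.2.1)) _ bV).
  apply: measurable_fun_pair; first exact: (measurableT_comp measurable_fst measurable_fst).
  exact: (measurableT_comp measurable_fst measurable_snd).
have bVY : bounded_measurable (fun w => V2 (Y (inr k1) w, Y (inr k2) w)).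
  apply: (bmf_comp (phi := fun w => (Y (inr k1) w, Y (inr k2) w)) _ bV2).
  exact: measurable_fun_pair.
have -> : sobol_mean = \int[P']_w V2 (Y (inr k1) w, Y (inr k2) w).
  rewrite (mean_two_indices mY indepY _ bV2)//.
  have bv1 z : bounded_measurable (fun z' => sobol_variance (z, z')).
    exact: (bmf_pair1 bV).
  rewrite /V2 /=; under eq_Rintegral do rewrite (mean_ball k2 (bv1 _)).
  rewrite (mean_ball k1 (g := fun z => \int[P]_w' sobol_variance (z, out w')))//.
  apply: (bmf_mean1 P (g := fun u : S * T => sobol_variance (u.1, out u.2))).
  apply: (bmf_comp (phi := fun u : S * T => (u.1, out u.2)) _ bV).
  apply: measurable_fun_pair; first exact: measurable_fst.
  exact: (measurableT_comp mout measurable_snd).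
(* the balls are drawn from w and the pairs from w' *)
pose J : {set idx} := [set i : idx | if i is inr _ then true else false]%SET.
rewrite (mean_resample mY indepY J (bmf_term k1 k2)).
have bG : bounded_measurable
    (fun w => \int[P']_w' term_of k1 k2 (mix J (Y^~ w) (Y^~ w'))).
  apply: (bmf_mean1 P' (g := fun u : T' * T' =>
    term_of k1 k2 (mix J (Y^~ u.1) (Y^~ u.2)))).
  exact: (bmf_comp (measurable_resample mY J) (bmf_term k1 k2)).
rewrite -meanB//; apply: mean_norm_le => [|w]; first exact: bmfB.
have -> : \int[P']_w' term_of k1 k2 (mix J (Y^~ w) (Y^~ w')) =
  \int[P']_w' pf_term (fun j => (Y (inl j) w').1) (fun j => (Y (inl j) w').2)
    (h (Y (inr k1) w).1 (Y (inr k2) w).1).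
  have mixl y y' j : mix J y y' (inl j) = y' (inl j) by rewrite /mix inE.
  have mixr y y' k : mix J y y' (inr k) = y (inr k) by rewrite /mix inE.
  apply: eq_Rintegral => w' _; rewrite /term_of !mixr.
  rewrite (_ : (fun j => (mix J _ _ (inl j)).1) = fun j => (Y (inl j) w').1);
    last by apply/funext => j; rewrite mixl.
  by rewrite (_ : (fun j => (mix J _ _ (inl j)).2) = fun j => (Y (inl j) w').2);
    last by apply/funext => j; rewrite mixl.
apply: mean_pf_term_fixed; [exact: bmf_ball|by move=> z; exact: h01].
Qed.

Lemma mean_stat : `|\int[P']_w stat_of (Y^~ w) - sobol_mean| <= N%:R^-1.
Proof.
have bt k1 k2 : bounded_measurable (fun w => term_of k1 k2 (Y^~ w)).
  exact: (bmf_comp (measurable_sample mY) (bmf_term k1 k2)).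
have C0 : 0 < 'C(N, 2)%:R :> R by rewrite ltr0n bin_gt0.
rewrite /stat_of /pf_stat meanZ; last first.
  exact: (bmf_sum (F := fun tau w => term_of tau.1 tau.2 (Y^~ w)) _ _
    (fun tau => bt tau.1 tau.2)).
rewrite (mean_sum P' _ _ (F := fun tau w => term_of tau.1 tau.2 (Y^~ w))); last first.
  by move=> tau; exact: bt.
have -> : sobol_mean = 'C(N, 2)%:R^-1 *
    \sum_(tau : 'I_N * 'I_N | (tau.1 < tau.2)%N) sobol_mean.
  rewrite -[X in \sum_(_ | _) X]mul1r -mulr_suml card_ordered_pairs mulKf//.
  by rewrite gt_eqF.
rewrite -mulrBr -sumrB; apply: (pairs_average_norm N1) => tau tt.
by apply: mean_term; rewrite -val_eqE /= ltn_eqF.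
Qed.

Lemma sobol_mean_norm : `|sobol_mean| <= 1.
Proof.
have bV := bmf_sobol_variance.
have b2 : bounded_measurable (fun u : T * T => sobol_variance (out u.1, out u.2)).
  apply: (bmf_comp (phi := fun u : T * T => (out u.1, out u.2)) _ bV).
  apply: measurable_fun_pair.
    exact: (measurableT_comp mout measurable_fst).
  exact: (measurableT_comp mout measurable_snd).
apply: mean_norm_le => [|w]; first exact: (bmf_mean1 P b2).
apply: mean_norm_le => [|w']; first exact: (bmf_pair1 b2).
rewrite /sobol_variance; set a := h _ _.
have ba : bounded_measurable a by exact: bmf_ball.
have a01 z : 0 <= a z <= 1 by exact: h01.
have p01 : 0 <= \int[P]_w a (out w) <= 1.
  have ca := bmf_comp mout ba.
  apply/andP; split; [apply: mean_ge_cst|apply: mean_le_cst] => // x;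
  by case/andP: (a01 (out x)).
have c01 : 0 <= \int[Q]_w (a (pair_out w).1 * a (pair_out w).2) <= 1.
  have ca : bounded_measurable (fun w => a (pair_out w).1 * a (pair_out w).2).
    apply: bmfM.
      exact: (bmf_comp (measurableT_comp measurable_fst mpair) ba).
    exact: (bmf_comp (measurableT_comp measurable_snd mpair) ba).
  apply/andP; split; [apply: mean_ge_cst|apply: mean_le_cst] => // x;
  have /andP[x0 x1] := a01 (pair_out x).1; have /andP[y0 y1] := a01 (pair_out x).2.
    by rewrite mulr_ge0.
  by rewrite mulr_ile1.
have p2 : 0 <= (\int[P]_w a (out w)) ^+ 2 <= 1.
  by rewrite sqr_ge0 exprn_ile1//; case/andP: p01.
by rewrite ler_norml; apply/andP; split; lra.
Qed.

(** With 2N blocks and differences 4/N, the choice l = N s / 128 and the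
deviation s/2 give the exponent
  2N (l * 4/N)^2 - l s/2 = - N s^2 / 512. *)
Lemma stat_concentration (s : R) : 0 < s -> 2 / s <= N%:R ->
  (P' [set w | `|stat_of (Y^~ w) - sobol_mean| > s]%R <=
    (16 * expR (- (N%:R * (s / 9) ^+ 2 / 8)))%:E)%E.
Proof.
move=> s0 sN; set A := [set w | _].
have [s2|s2] := leP 2 s.
  (* the statistic and its target lie in [-1, 1] *)
  have -> : A = set0.
    rewrite -subset0 => w; rewrite /A /= => sw.
    have := ler_normB (stat_of (Y^~ w)) sobol_mean.
    have := pf_stat_norm h01 N1 (fun j => (Y (inl j) w).1)
      (fun j => (Y (inl j) w).2) (fun k => (Y (inr k) w).1).
    have := sobol_mean_norm; rewrite -/(stat_of (Y^~ w)); lra.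
  by rewrite measure0 lee_fin mulr_ge0 ?expR_ge0.
have ms := measurable_sample mY.
have bS := bmf_stat.
pose negS y := - stat_of y.
have bN : bounded_measurable negS.
  rewrite (_ : negS = fun y => -1 * stat_of y); first exact: bmfZ.
  by apply/funext => y; rewrite mulN1r.
have vN : variation_bound negS (fun=> 4 / N%:R).
  by move=> k y y' yy'; rewrite /negS -opprD normrN; exact: variation_stat yy'.
pose l := N%:R * s / 128.
have c0 : 0 <= 4 / N%:R :> R by rewrite divr_ge0.
have l0 : 0 <= l by rewrite /l divr_ge0 ?mulr_ge0 ?ltW.
have lc : l * (4 / N%:R) <= 1 / 4.
  have -> : l * (4 / N%:R) = s / 32 by rewrite /l; field; rewrite gt_eqF.
  lra.
have up := bounded_differences_upper mY indepY (s / 2) bS variation_stat c0 l0 lc.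
have dn := bounded_differences_upper mY indepY (s / 2) bN vN c0 l0 lc.
set bd := expR _ in up; rewrite -/bd in dn.
have bdE : bd = expR (- (N%:R * s ^+ 2 / 512)).
  rewrite /bd card_sum !card_ord natrD /l; congr expR.
  by field; rewrite gt_eqF.
set U := [set w | _] in up; set D := [set w | _] in dn.
have mset (F : famType (S * S)%type idx -> R) r : bounded_measurable F ->
    measurable [set w | r < F (Y^~ w)].
  move=> bF; rewrite (_ : [set w | _] = (fun w => F (Y^~ w)) @^-1` `]r, +oo[).
    by rewrite -[X in measurable X]setTI; apply: (bmf_comp ms bF).1.
  by apply/seteqP; split=> w /=; rewrite in_itv/= andbT.
have mU : measurable U by exact: mset.
have mD : measurable D by exact: mset.
have mA : measurable A.
  have bm : bounded_measurable (fun y => stat_of y - sobol_mean).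
    by apply: bmfB => //; exact: bmf_cst.
  rewrite (_ : A = [set w | s < stat_of (Y^~ w) - sobol_mean] `|`
      [set w | s < -1 * (stat_of (Y^~ w) - sobol_mean)]).
    apply: measurableU; first exact: (mset _ s bm).
    exact: (mset _ s (bmfZ (-1) bm)).
  apply/seteqP; split=> w; rewrite /A /= ltr_normr mulN1r; first by move/orP.
  by move=> h'; apply/orP.
have AUD : A `<=` U `|` D.
  move=> w; rewrite /A /U /D /negS /= ltr_normr.
  have mneg : \int[P']_w' - stat_of (Y^~ w') = - \int[P']_w' stat_of (Y^~ w').
    rewrite -[RHS]mulN1r -meanZ; last exact: bmf_comp ms bS.
    by under [RHS]eq_Rintegral do rewrite mulN1r.
  rewrite mneg.
  have := mean_stat; rewrite ler_norml.
  have : N%:R^-1 <= s / 2.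
    by rewrite -[s / 2]invrK lef_pV2 ?posrE ?invr_gt0 ?divr_gt0// invf_div.
  move=> h1 /andP[h2 h3] /orP[h4|h4]; [left|right]; lra.
apply: (@le_trans _ _ (P' (U `|` D))).
  by apply: le_measure; rewrite ?inE//; exact: measurableU.
apply: le_trans (measureU2 _ mU mD) _.
apply: le_trans (leeD up dn) _.
rewrite -EFinD lee_fin bdE.
apply: (@le_trans _ _ (2 * expR (- (N%:R * (s / 9) ^+ 2 / 8)))).
  rewrite -mulr2n -[leLHS]mulr_natl ler_wpM2l// ler_expR lerN2.
  rewrite (_ : N%:R * (s / 9) ^+ 2 / 8 = N%:R * s ^+ 2 / 648); last by field.
  have : 0 <= N%:R * s ^+ 2 by rewrite mulr_ge0 ?sqr_ge0.
  lra.
by rewrite ler_wpM2r ?expR_ge0// ler_nat.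
Qed.

End sample.

(** * The pick-freeze sample *)

(** An open set of R^dim is the countable union of the cubes with rational
centre and radius 1/(k+1) that it contains. *)
Lemma measurable_continuous_row (R : realType) (M : completeMetricType R) dim
    (f : 'rV[R]_dim -> M) : continuous f ->
  measurable_fun setT (fun x : famType R 'I_dim => f (\row_i x i) : borel M).
Proof.
move=> cf.
apply: (@measurability _ _ (famType R 'I_dim) (borel M) setT _ (@open M)) => //.
move=> _ [U oU <-]; rewrite setTI.
pose V := f @^-1` U.
have oV : open V by apply: open_comp => // x _; exact: cf.
pose cube (qk : 'rV[rat]_dim * nat) : set (famType R 'I_dim) :=
  box (fun i => ball (ratr (qk.1 0 i) : R) (qk.2.+1%:R^-1)).
rewrite (_ : _ @^-1` U = \bigcup_(qk in [set qk | cube qk `<=` [set x | V (\row_i x i)]]) cube qk).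
  rewrite bigcup_mkcond; apply: countable_bigcupT_measurable => [|qk]; first exact: countableP.
  case: ifP => _; last exact: measurable0.
  by apply: measurable_box => i; exact: measurable_ball.
apply/seteqP; split=> [x Vx|x [qk /= qV xq]]; last exact: qV xq.
have /nbhs_ballP[e /= e0 eV] : nbhs (\row_i x i) V by exact: open_nbhs_nbhs.
have [k kr] := inv_succ_lt (divr_gt0 e0 (ltr0n R 2)).
have k0 : 0 < k.+1%:R^-1 :> R by rewrite invr_gt0.
have /choice[q xq] : forall i, exists r : rat, `|ratr r - x i| < k.+1%:R^-1.
  move=> i; have : x i - k.+1%:R^-1 < x i by rewrite ltrBlDr ltrDl.
  move=> /rat_in_itvoo[r]; rewrite in_itv /= => /andP[r1 r2].
  exists r; move: k.+1%:R^-1 k0 r1 {kr} => u u0 r1.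
  by rewrite ltr_norml; apply/andP; split; lra.
exists (\row_i q i, k) => [y yq|i]; last by rewrite /ball /= mxE.
apply: eV; split => // a i; rewrite (ord1 a) !mxE.
have := yq i; have := xq i; rewrite /ball /= mxE.
move: (ratr _) (k.+1%:R^-1) kr {k0 xq yq} => z u ku.
by rewrite !ltr_norml => /andP[? ?] /andP[? ?]; apply/andP; split; lra.
Qed.

Lemma independent_sum d (T : measurableType d) (R : realType)
    (P : probability T R) dE (E : measurableType dE) (I1 I2 : finType)
    (Y1 : I1 -> T -> E) (Y2 : I2 -> T -> E) :
  mutually_independent P Y1 -> mutually_independent P Y2 ->
  (forall A B, sigma_of setT Y1 A -> sigma_of setT Y2 B -> P (A `&` B) = (P A * P B)%E) ->
  mutually_independent P
    (fun i : I1 + I2 => match i with inl j => Y1 j | inr k => Y2 k end).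
Proof.
move=> ind1 ind2 ind12 J A mA.
pose J1 := [set j | inl j \in J]%SET; pose J2 := [set k | inr k \in J]%SET.
rewrite (_ : \bigcap_(i in _) _ =
  (\bigcap_(j in [set` J1]) Y1 j @^-1` A (inl j)) `&`
  (\bigcap_(k in [set` J2]) Y2 k @^-1` A (inr k))); last first.
  apply/seteqP; split=> [w Aw|w [Aw1 Aw2] [j|k] iJ].
  - by split=> [j|k]; rewrite /= inE; [exact: (Aw (inl j))|exact: (Aw (inr k))].
  - by apply: (Aw1 j); rewrite /= inE.
  - by apply: (Aw2 k); rewrite /= inE.
have capS dK (EK : measurableType dK) (K : finType) (Y : K -> T -> EK) (L : {set K}) B :
    (forall k, measurable (B k)) ->
    sigma_of setT Y (\bigcap_(k in [set` L]) Y k @^-1` B k).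
  move=> mB; rewrite /sigma_of; set G := (X in <<s X >>).
  apply: (@fin_bigcap_measurable _ (g_sigma_algebraType G)) => [|k _].
    exact: finite_finset.
  by apply: sub_sigma_algebra; exists k; exists (B k).
rewrite ind12; [|exact: capS|exact: capS].
rewrite ind1// ind2// big_sumType /=.
by congr (_ * _)%E; apply: eq_bigl => i; rewrite inE.
Qed.

Theorem mainTheorem2
  (R : realType)
  (* the manifold, with its Riemannian distance and its volume measure *)
  (n : nat) (M : completeMetricType R)
  (g : oriented_riemannian_structure R M n)
  (Mconn : connected [set: M])
  (Msep : separable_space M)
  (Mdist : forall p q : M, mdist p q = riemannian_distance g p q)
  (vol : {measure set (borel M) -> \bar R})
  (Mvol : is_volume_measure g vol)
  (* the input X, the function f and the output Z = f(X) *)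
  (d : measure_display) (T : measurableType d) (P : probability T R)
  (dim : nat) (X : 'I_dim -> {RV P >-> R})
  (Xindep : mutually_independent P X)
  (f : 'rV[R]_dim -> M) (fcont : continuous f)
  (Zdensity : exists rho : borel M -> \bar R,
    [/\ measurable_fun [set: borel M] rho,
        forall z, (0 <= rho z)%E &
        forall A : set (borel M), measurable A ->
          P (output X f @^-1` A) = (\int[vol]_(z in A) rho z)%E])
  (Zgeod : {ae (P \x P)%E, forall w : T * T, exists gam,
    unique_minimizing_geodesic (output X f w.1) (output X f w.2) gam})
  (nu : {set 'I_dim}) (s : R) (s0 : 0 < s) :
  exists N0 : nat, forall N : nat, (N0 < N)%N ->
  forall (d' : measure_display) (T' : measurableType d')
    (P' : probability T' R)
    (Z Znu W : 'I_N -> {RV P' >-> borel M}),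
  (* the pairs (Z_j, Z_j^nu) are independent copies of (Z, Z^nu) *)
  mutually_independent P'
    (fun j w => (Z j w, Znu j w) : borel M * borel M) ->
  (forall j (A : set (borel M * borel M)), measurable A ->
    P' ((fun w => (Z j w, Znu j w)) @^-1` A) =
      (P \x P)%E (pick_freeze_pair X f nu @^-1` A)) ->
  (* the W_j are independent copies of Z, independent of these pairs *)
  mutually_independent P' W ->
  (forall j (A : set (borel M)), measurable A ->
    P' (W j @^-1` A) = P (output X f @^-1` A)) ->
  independent_families P' W
    (fun j w => (Z j w, Znu j w) : borel M * borel M) ->
  (P' [set w | `|pick_freeze_estimator (Z ^~ w) (Znu ^~ w) (W ^~ w)
                 - ball_sensitivity X f nu| > s]%R
    <= (16 * expR (- (N%:R * (s / 9) ^+ 2 / 8)))%:E)%E.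
Proof.
have lcM := locally_compact_manifold g.
have h01 (a b c : borel M) : 0 <= (ball_ind (a : M) b c : R) <= 1.
  by rewrite /ball_ind indicE; case: (_ \in _); rewrite /= ?lexx ?ler01.
have bh : bounded_measurable (fun u : (borel M * borel M) * borel M =>
    (ball_ind (u.1.1 : M) u.1.2 u.2 : R)).
  rewrite (_ : (fun u => _) = \1_[set u : (borel M * borel M) * borel M |
    geodesic_ball (u.1.1 : M) (u.1.2 : M) u.2]).
    by apply: bmf_indic; exact: (measurable_geodesic_ball lcM Msep).
  apply/funext => u; rewrite /ball_ind !indicE.
  have [uB|uB] := pselect (geodesic_ball (u.1.1 : M) (u.1.2 : M) u.2).
    by rewrite !mem_set.
  by rewrite !memNset.
have mX i : measurable_fun setT (X i : T -> R) by exact: measurable_funPT.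
pose Xf : 'I_dim -> T -> R := fun i => X i.
have mXf : forall i, measurable_fun setT (Xf i) by move=> i; exact: mX.
have iX : mutually_independent P Xf by exact: Xindep.
pose reg : famType R 'I_dim -> borel M := fun x => f (\row_i x i).
have mreg : measurable_fun setT reg by exact: measurable_continuous_row.
pose out : T -> borel M := output X f.
have mout : measurable_fun setT out.
  exact: (measurableT_comp mreg (measurable_sample mXf)).
pose pairo : T * T -> borel M * borel M := pick_freeze_pair X f nu.
have pairE w : (pairo w).2 = reg (mix nu (Xf^~ w.1) (Xf^~ w.2)).
  rewrite /pairo /pick_freeze_pair /reg /=; congr f; apply/rowP => i.
  by rewrite !mxE /mix; case: ifP.
have mpair2 : measurable_fun setT (fun w => (pairo w).2).
  rewrite (_ : (fun w => _) = reg \o (fun w => mix nu (Xf^~ w.1) (Xf^~ w.2))).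
    exact: (measurableT_comp mreg (measurable_resample mXf nu)).
  by apply/funext => w; rewrite pairE.
have mpair1 : measurable_fun setT (fun w => (pairo w).1).
  exact: (measurableT_comp mout measurable_fst).
have mpair : measurable_fun setT pairo.
  by apply/measurable_fun_pairP.
have law1 (a : borel M -> R) : bounded_measurable a ->
    \int[(P \x P)%E]_w a (pairo w).1 = \int[P]_w a (out w).
  move=> ba; rewrite mean_prod12; last exact: (bmf_comp mpair1 ba).
  by apply: eq_Rintegral => w _; exact: (mean_cst P (a (out w))).
have law2 (a : borel M -> R) : bounded_measurable a ->
    \int[(P \x P)%E]_w a (pairo w).2 = \int[P]_w a (out w).
  move=> ba; rewrite mean_prod12; last exact: (bmf_comp mpair2 ba).
  rewrite [RHS](mean_resample mXf iX nu (bmf_comp mreg ba)).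
  by apply: eq_Rintegral => w _; apply: eq_Rintegral => w' _; rewrite pairE.
pose h (a b c : borel M) : R := ball_ind (a : M) b c.
have bV := bmf_sobol_variance bh P (P \x P)%E mout mpair.
have SE : ball_sensitivity X f nu = sobol_mean h P (P \x P)%E out pairo.
  rewrite /ball_sensitivity unlock.
  transitivity (\int[(P \x P)%E]_w sobol_variance h P (P \x P)%E out pairo
    (out w.1, out w.2)).
    apply: eq_Rintegral => w _; rewrite /cond_ball_prob.
    have bphi : bounded_measurable (fun x : famType R 'I_dim =>
        h (out w.1) (out w.2) (reg x)).
      exact: (bmf_comp mreg (bmf_ball bh (out w.1) (out w.2))).
    rewrite [LHS](variance_cond_exp nu mXf iX bphi).
    rewrite /sobol_variance; congr (_ - _).
    rewrite mean_prod12.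
      by apply: eq_Rintegral => v _; apply: eq_Rintegral => v' _; rewrite pairE.
    have ba := bmf_ball bh (out w.1) (out w.2).
    by apply: bmfM; [exact: (bmf_comp mpair1 ba)|exact: (bmf_comp mpair2 ba)].
  rewrite mean_prod12//.
  apply: (bmf_comp (phi := fun w : T * T => (out w.1, out w.2)) _ bV).
  apply: measurable_fun_pair; first exact: (measurableT_comp mout measurable_fst).
  exact: (measurableT_comp mout measurable_snd).
(* N > 2 / s makes the bias 1/N at most s/2; N > 1 makes the number of balls
   positive *)
exists (maxn 1 (Num.truncn (2 / s))) => N.
rewrite gtn_max => /andP[N1 Ns] d' T' P' Z Znu W indZ lawZ indW lawW indZW.
have sN : 2 / s <= N%:R.
  by apply/ltW/(lt_le_trans (truncnS_gt _)); rewrite ler_nat.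
pose Y (i : 'I_N + 'I_N) : T' -> borel M * borel M :=
  match i with inl j => fun w => (Z j w, Znu j w) | inr k => fun w => (W k w, W k w) end.
have mdiag : measurable_fun setT (fun x : borel M => (x, x)).
  by apply: measurable_fun_pair.
have mY i : measurable_fun setT (Y i).
  by case: i => [j|k]; apply: measurable_fun_pair; exact: measurable_funPT.
have indWW : mutually_independent P' (fun (k : 'I_N) w => (W k w, W k w) : borel M * borel M).
  move=> J A mA; apply: (indW J (fun k => (fun x => (x, x)) @^-1` A k)) => k.
  by rewrite -[X in measurable X]setTI; exact: mdiag.
have sub A : sigma_of setT (fun (k : 'I_N) w => (W k w, W k w) : borel M * borel M) A ->
    sigma_of setT (fun k => W k : T' -> borel M) A.
  move: A; apply: smallest_sub; first exact: smallest_sigma_algebra.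
  move=> _ [k [A [_ mA ->]]]; apply: sub_sigma_algebra.
  exists k; exists ((fun x => (x, x)) @^-1` A); split => //.
  by rewrite -[X in measurable X]setTI; exact: mdiag.
have iY : mutually_independent P' Y.
  have := independent_sum indZ indWW; rewrite (_ : (fun i => _) = Y); last first.
    by apply/funext => -[].
  apply => A B hA hB; rewrite setIC muleC.
  by apply: indZW => //; exact: sub.
rewrite SE.
have := @stat_concentration _ (borel M) R h bh h01 _ _ P _ _ (P \x P)%E out pairo
  mout mpair law1 law2 N N1 _ _ P' Y mY iY lawZ lawW s s0 sN.
exact.
Qed.
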